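(* Let $d=1$, let $W=\frac1{2R}\chi_{[-R,R]}$ with $0<R<1/2$ be the normalized top-hat kernel, and let $\varrho_0>0$, $\alpha>0$, $K\ge1$. If the first Fourier mode is critical, i.e. $$-\varrho_0g_0g_1\widehat W_1|q_1|^2\,I_1^0(\alpha)(\varrho_0)=1,$$ then it is automatically simple, i.e. for all integers $n\ge2$, $$-\varrho_0g_0g_1\widehat W_n|q_n|^2\,I_n^0(\alpha)(\varrho_0)\ne1 .$$
   Context: $\Omega=(0,1)$ is the one-dimensional torus and $W$ is extended periodically. $G:\mathbb R^+\to\mathbb R^+$ is bounded, positive and decreasing, $g_0:=G(\varrho_0)>0$, $g_1:=G'(\varrho_0)<0$. $q_n:=2\pi n$, $\widehat W_n:=\int_\Omega W(x)e^{-iq_nx}dx=\frac{\sin(2\pi nR)}{2\pi nR}$ for $n\ne0$. $$I_n^0(\alpha)(\varrho):=\frac1{\alpha^{2K+1}}\int_0^\infty F_K(\tau)^2\exp\Big(-\frac{|q_n|^2G(\varrho)^2}{2\alpha^{2K+1}}\widetilde V(\tau)\Big)d\tau,\qquad F_K(\tau):=\frac1{(K-1)!}\int_0^\tau e^{-s}s^{K-1}ds,$$ and $\widetilde V(\tau):=\operatorname{Var}\big(\int_0^\tau\widetilde Y_s^1ds\big)$, where $(\widetilde Y_s)_{s\ge0}$ is the stationary $\mathbb R^K$-valued Ornstein--Uhlenbeck process $d\widetilde Y_s=\widetilde A\widetilde Y_s\,ds+e_K\,dB_s$, $B$ a one-dimensional Brownian motion, $e_K=(0,\dots,0,1)^T$,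 $\widetilde A_{jj}=-1$, $\widetilde A_{j,j+1}=1$, all other entries of $\widetilde A\in\mathbb R^{K\times K}$ zero, and $\widetilde Y_0$ independent of $B$ with the invariant law $\mathcal N(0,\int_0^\infty e^{t\widetilde A}e_Ke_K^Te^{t\widetilde A^T}dt)$. *)

(* Defs.v *)
From HB Require Import structures.
From mathcomp Require Import all_boot all_order all_algebra.
From mathcomp Require Import complex.
From mathcomp Require Import all_classical all_reals all_analysis.

Set Implicit Arguments.
Unset Strict Implicit.
Unset Printing Implicit Defensive.

Import Order.TTheory GRing.Theory Num.Theory.
Import numFieldNormedType.Exports.

Local Open Scope classical_set_scope.
Local Open Scope ring_scope.

Section top_hat.
Context {R : realType}.

(* The top-hat kernel (2r)^-1 \chi_[-r, r], extended with period 1. *)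
Definition tophat (r x : R) : R :=
  (2 * r)^-1 * \1_[set y : R | exists m : int, `|y - m%:~R| <= r] x.

Definition wavenumber (n : int) : R := 2 * pi * n%:~R.

Definition expi (t : R) : R[i] := Complex (cos t) (sin t).

Definition Cintegral (D : set R) (f : R -> R[i]) : R[i] :=
  Complex (\int[lebesgue_measure]_(x in D) complex.Re (f x))
          (\int[lebesgue_measure]_(x in D) complex.Im (f x)).

Definition fourier_coef (W : R -> R) (n : int) : R[i] :=
  Cintegral `]0, 1[
    (fun x => real_complex R (W x) * expi (- (wavenumber n * x))).

End top_hat.

Section random_processes.
Context {R : realType} {d : measure_display} {T : measurableType d}.
Variable P : probability T R.

Definition indep_systems (F H : set_system T) : Prop :=
  forall A C, F A -> H C -> P (A `&` C) = (P A * P C)%E.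

(* The sigma-algebra on T generated by the variables X i, i ranging over D. *)
Definition sigma_generated {I : Type} (D : set I) (X : I -> T -> R) :
    set_system T :=
  <<s [set A | exists2 i, D i & exists2 U, measurable U & A = X i @^-1` U] >>.

(* X has law N(m, v), v being the variance.  The case v = 0 is separate because
   normal_prob m 0 is the uniform law on [0, 1] and not the Dirac mass at m. *)
Definition has_normal_law (X : T -> R) (m v : R) : Prop :=
  forall U : set R, measurable U ->
    P (X @^-1` U) = if v == 0 then \d_m U else normal_prob m (Num.sqrt v) U.

(* The vector X has law N(0, S): every linear combination a^T X has law
   N(0, a^T S a). *)
Definition has_centered_normal_law {K : nat} (X : 'I_K -> T -> R)
    (S : 'M[R]_K) : Prop :=
  forall a : 'cV[R]_K,
    has_normal_law (fun w => \sum_(i < K) a i 0 * X i w) 0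
      ((a^T *m S *m a) 0 0).

Definition brownian_motion (B : R -> {RV P >-> R}) : Prop :=
  [/\ {ae P, forall w, B 0 w = 0},
      forall w, {within `[0, +oo[, continuous (fun t => B t w)},
      forall s t, 0 <= s -> s < t ->
        has_normal_law (fun w => B t w - B s w) 0 (t - s) &
      forall s t, 0 <= s -> s < t ->
        indep_systems
          (sigma_generated [set: unit] (fun=> fun w => B t w - B s w))
          (sigma_generated `[0, s] (fun u w => B u w))].

(* The matrix exponential, as an entrywise sum of its power series. *)
Definition expmx {K : nat} (M : 'M[R]_K) : 'M[R]_K :=
  \matrix_(i, j) limn (series (fun k => (k`!%:R^-1 *: (M ^+ k)) i j)).

Definition ou_drift (K : nat) : 'M[R]_K :=
  \matrix_(i, j)
    if i == j then -1 else if j == i.+1 :> nat then 1 else 0.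

Definition ou_noise (K : nat) : 'cV[R]_K :=
  \col_i (if i.+1 == K then 1 else 0).

(* Covariance of the invariant law,
   \int_0^oo e^{tA} e_K e_K^T e^{tA^T} dt, entry by entry. *)
Definition ou_invariant_cov (K : nat) : 'M[R]_K :=
  \matrix_(i, j)
    \int[lebesgue_measure]_(t in `[0, +oo[)
      (expmx (t *: ou_drift K) *m ou_noise K *m (ou_noise K)^T
        *m expmx (t *: (ou_drift K)^T)) i j.

(* Y solves dY = A Y ds + e_K dB on [0, +oo[ and starts, independently of B,
   from the invariant law.  As the noise is additive, the stochastic integral
   of the constant vector e_K is e_K (B_t - B_0), so the equation in integral
   form is understood path by path. *)
Definition stationary_ou {K : nat} (B : R -> {RV P >-> R})
    (Y : R -> 'I_K -> {RV P >-> R}) : Prop :=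
  [/\ forall w i, {within `[0, +oo[, continuous (fun t => Y t i w)},
      {ae P, forall w, forall t i, 0 <= t ->
        Y t i w = Y 0 i w
          + \int[lebesgue_measure]_(s in `[0, t])
              (\sum_(j < K) ou_drift K i j * Y s j w)
          + ou_noise K i 0 * (B t w - B 0 w)},
      has_centered_normal_law (fun i w => Y 0 i w) (ou_invariant_cov K) &
      indep_systems
        (sigma_generated [set: 'I_K] (fun i w => Y 0 i w))
        (sigma_generated `[0, +oo[ (fun t w => B t w))].

Definition integrated_variance (Z : R -> T -> R) (tau : R) : R :=
  fine 'V_P[fun w => \int[lebesgue_measure]_(s in `[0, tau]) Z s w].

End random_processes.

Section dispersion.
Context {R : realType}.

Definition F_ (K : nat) (tau : R) : R :=
  (K.-1)`!%:R^-1 *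
  \int[lebesgue_measure]_(s in `[0, tau]) (expR (- s) * s ^+ K.-1).

Definition I0 (V : R -> R) (G : R -> R) (K : nat) (n : int) (alpha rho : R) :
    R :=
  (alpha ^+ (2 * K + 1))^-1 *
  \int[lebesgue_measure]_(tau in `[0, +oo[)
    (F_ K tau ^+ 2 *
     expR (- (`|wavenumber n| ^+ 2 * G rho ^+ 2
              / (2 * alpha ^+ (2 * K + 1)) * V tau))).

End dispersion.

(* Main.v *)
Require Import Defs.
From HB Require Import structures.
From mathcomp Require Import all_boot all_order all_algebra.
From mathcomp Require Import complex.
From mathcomp Require Import all_classical all_reals all_analysis.
From mathcomp Require Import measurable_realfun ring lra.

Set Implicit Arguments.
Unset Strict Implicit.
Unset Printing Implicit Defensive.

Import Order.TTheory GRing.Theory Num.Theory.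
Import numFieldNormedType.Exports.
Local Open Scope classical_set_scope.
Local Open Scope ring_scope.

(* Let N = K - 1 and P_j = F_(j+1).  Pathwise integration by parts gives
   \int_0^tau Y^1 ds =
     \sum_(i <= N) P_i(tau) Y_0^i + \int_0^tau P_N'(tau - s) (B_s - B_0) ds,
   two uncorrelated terms with explicit variances, so that V' = 2 \sum_j c_j P_j
   with positive c_j.  As P_j / P_N is nonincreasing for j <= N, P_N^2 / V' is
   nondecreasing.  Since \int V' l exp(- l V) = 1 for every l > 0, it follows
   that l \int P_N^2 exp(- l V) is nonincreasing in l, i.e. that |q_n|^2 I_n is
   nonincreasing in n.  The Fourier coefficients satisfy |W_n| < W_1 for n >= 2
   because |sin (n x)| < n sin x on ]0, pi[. *)

(** No stochastic integral is ever constructed: integration by parts moves the derivative from the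
    noise to the smooth kernel, leaving a Lebesgue integral of the continuous path [B s - B 0]. Its
    second moment follows by Fubini from the covariance [Num.min s u], and elementary calculus gives
    the value \int_0^tau P_N^2 expected from Ito's isometry. The initial part has variance p^T S p,
    with p = (P_0, ..., P_N) and S the invariant covariance; by the Lyapunov equation its derivative
    is 2 \sum_j c_j P_j - P_N^2, so the squares cancel in the total and V' is linear in the P_j. The
    constants c_j form the first row of S. The monotonicity in n is not strict; the strict
    inequality comes from the Fourier coefficients. Real integrals take the value 0 when the
    extended integral is infinite, so the comparison is made in the extended reals. Criticality of
    the first mode makes its integral nonzero, hence finite, and the comparison then makes the
    integrals of the higher modes finite too. *)

Section real_calculus.
Context {R : realType}.
Implicit Types (f g F : R -> R) (a b x : R).

Lemma is_deriveD_fun f g x a b : is_derive x 1 f a -> is_derive x 1 g b ->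
  is_derive x 1 (fun t => f t + g t) (a + b).
Proof. exact: is_deriveD. Qed.

Lemma is_deriveB_fun f g x a b : is_derive x 1 f a -> is_derive x 1 g b ->
  is_derive x 1 (fun t => f t - g t) (a - b).
Proof. exact: is_deriveB. Qed.

Lemma is_deriveN_fun f x a : is_derive x 1 f a ->
  is_derive x 1 (fun t => - f t) (- a).
Proof. exact: is_deriveN. Qed.

Lemma is_deriveM_fun f g x a b : is_derive x 1 f a -> is_derive x 1 g b ->
  is_derive x 1 (fun t => f t * g t) (a * g x + f x * b).
Proof.
move=> df dg; apply: (is_derive_eq (f' := f x *: b + g x *: a)).
by rewrite /GRing.scale/= addrC [g x * a]mulrC.
Qed.

Lemma is_deriveZ_fun c f x a : is_derive x 1 f a ->
  is_derive x 1 (fun t => c * f t) (c * a).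
Proof. exact: is_deriveZ. Qed.

Lemma is_derive_sum_fun n (f : 'I_n -> R -> R) x (a : 'I_n -> R) :
  (forall i, is_derive x 1 (f i) (a i)) ->
  is_derive x 1 (fun t => \sum_(i < n) f i t) (\sum_(i < n) a i).
Proof.
move=> df; rewrite (_ : (fun t => _) = \sum_(i < n) f i).
  exact: is_derive_sum.
by apply/funext => t; rewrite fct_sumE.
Qed.

Lemma is_derive_comp_fun f g x a b : is_derive (g x) 1 f a ->
  is_derive x 1 g b -> is_derive x 1 (fun t => f (g t)) (a * b).
Proof. by move=> df dg; exact: (@is_derive1_comp _ f g). Qed.

Lemma is_derive_reflect f c x a : is_derive (c - x) 1 f a ->
  is_derive x 1 (fun t => f (c - t)) (- a).
Proof.
move=> df; have dc : is_derive x 1 (fun t => c - t) (0 - 1).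
  exact: (is_deriveB_fun (is_derive_cst c x (1 : R)) (is_derive_id x (1 : R))).
refine (is_derive_eq (@is_derive_comp_fun f (fun t => c - t) x _ _ df dc) _).
by rewrite sub0r mulrN1.
Qed.

Lemma is_deriveX_fun n x : is_derive x 1 (fun t => t ^+ n) (n%:R * x ^+ n.-1).
Proof.
rewrite (_ : (fun t => _) = id ^+ n); last by apply/funext => t; rewrite exprfctE.
refine (is_derive_eq (is_deriveX n (is_derive_id x 1)) _).
by rewrite /GRing.scale/= mulr1.
Qed.

Lemma is_derive_derive1 f x a : is_derive x 1 f a -> (f^`())%classic x = a.
Proof. by move=> df; rewrite derive1E; exact: derive_val. Qed.

Lemma is_derive_continuous f x a : is_derive x 1 f a -> {for x, continuous f}.
Proof.
by move=> df; apply: differentiable_continuous; apply/derivable1_diffP/ex_derive.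
Qed.

Lemma is_derive_nondecreasing f (f' : R -> R) c :
  (forall x, is_derive x 1 f (f' x)) -> (forall x, c < x -> 0 <= f' x) ->
  forall a b, c <= a -> a <= b -> f a <= f b.
Proof.
move=> df f'0 a b ca ab; apply: (@ger0_derive1_ndecry _ f c) => //.
- move=> x; rewrite in_itv/= andbT => cx.
  by rewrite (is_derive_derive1 (df x)); exact: f'0.
- by apply: continuous_subspaceT => x; exact: is_derive_continuous (df x).
Qed.

Lemma integrable_continuous f a b : continuous f ->
  (@lebesgue_measure R).-integrable `[a, b] (EFin \o f).
Proof.
move=> cf; apply: continuous_compact_integrable; first exact: segment_compact.
exact: continuous_subspaceT.
Qed.

Lemma EFin_Rintegral_continuous f a b : continuous f ->
  (\int[lebesgue_measure]_(x in `[a, b]) (f x)%:E =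
   (\int[lebesgue_measure]_(x in `[a, b]) f x)%:E)%E.
Proof.
move=> cf; rewrite /Rintegral fineK//; apply: integrable_fin_num => //.
exact: integrable_continuous.
Qed.

Lemma integral_is_derive f F a b : a <= b -> continuous f ->
  (forall x, is_derive x 1 F (f x)) ->
  (\int[lebesgue_measure]_(x in `[a, b]) (f x)%:E = (F b - F a)%:E)%E.
Proof.
rewrite le_eqVlt => /predU1P[<- _ _|ab cf dF].
  by rewrite set_itv1 integral_set1 subrr.
have cF : continuous F by move=> x; exact: is_derive_continuous (dF x).
rewrite (continuous_FTC2 ab _ _ _ (F := F)) ?EFinB//.
- exact: continuous_subspaceT.
- split.
  + by move=> x _; exact: ex_derive.
  + exact/cvg_at_right_filter/cF.
  + exact/cvg_at_left_filter/cF.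
- by move=> x _; exact: is_derive_derive1.
Qed.

Lemma Rintegral_is_derive f F a b : a <= b -> continuous f ->
  (forall x, is_derive x 1 F (f x)) ->
  \int[lebesgue_measure]_(x in `[a, b]) f x = F b - F a.
Proof. by move=> ab cf dF; rewrite /Rintegral (integral_is_derive ab cf dF). Qed.

End real_calculus.

(** * Erlang densities and regularized incomplete gamma functions *)

Section gamma_functions.
Context {R : realType}.
Implicit Types (m n k : nat) (t x y a b : R).

(** Density of the Gamma law of shape m + 1 and rate 1; also the entry of exp(t A) on the m-th
    superdiagonal, A being the drift matrix. *)
Definition psi m t : R := m`!%:R^-1 * (t ^+ m * expR (- t)).

(** The function P_m, the distribution function of that Gamma law, written as a Poisson tail: this
    closed form is smooth on the whole line and needs no integral. *)
Definition gammaP m t : R := 1 - \sum_(i < m.+1) psi i t.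

Lemma psi_ge0 m t : 0 <= t -> 0 <= psi m t.
Proof. by move=> t0; rewrite /psi !mulr_ge0 ?expR_ge0 ?exprn_ge0 ?invr_ge0. Qed.

Lemma psi_gt0 m t : 0 < t -> 0 < psi m t.
Proof.
move=> t0; by rewrite /psi !mulr_gt0 ?expR_gt0 ?exprn_gt0// invr_gt0 ltr0n fact_gt0.
Qed.

Lemma psi_at0 m : psi m 0 = (m == 0)%:R :> R.
Proof.
rewrite /psi oppr0 expR0 mulr1 expr0n; case: m => [|m] /=; rewrite ?mulr0//.
by rewrite invr1 mulr1.
Qed.

Let is_derive_expRN t : is_derive t 1 (fun x => expR (- x)) (- expR (- t)).
Proof.
by apply: (is_derive_eq (f' := expR (- t) * -1)); rewrite mulrN1.
Qed.

Lemma is_derive_psi0 t : is_derive t 1 (psi 0) (- psi 0 t).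
Proof.
have -> : psi 0 = (fun t : R => expR (- t)).
  by apply/funext => x; rewrite /psi fact0 invr1 expr0 !mul1r.
exact: is_derive_expRN.
Qed.

Lemma is_derive_psiS m t : is_derive t 1 (psi m.+1) (psi m t - psi m.+1 t).
Proof.
refine (is_derive_eq (is_deriveZ_fun _ (is_deriveM_fun (is_deriveX_fun m.+1 t)
  (is_derive_expRN t))) _).
rewrite /psi factS natrM invfM /=.
have m0 : m.+1%:R != 0 :> R by rewrite pnatr_eq0.
have f0 : m`!%:R != 0 :> R by rewrite pnatr_eq0 -lt0n fact_gt0.
rewrite mulrDr; congr (_ + _); last by rewrite !mulrN.
move: (m.+1%:R : R) (m`!%:R : R) m0 f0 => u v u0 v0; field; rewrite u0 v0//.
Qed.

Lemma gammaPS m t : gammaP m.+1 t = gammaP m t - psi m.+1 t.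
Proof. by rewrite /gammaP [in LHS]big_ord_recr/= opprD addrA. Qed.

Lemma gammaP0 t : gammaP 0 t = 1 - psi 0 t.
Proof. by rewrite /gammaP big_ord_recl big_ord0 addr0. Qed.

Lemma is_derive_gammaP m t : is_derive t 1 (gammaP m) (psi m t).
Proof.
elim: m => [|m IH].
  have -> : gammaP 0 = fun t => 1 - psi 0 t :> R by exact/funext/gammaP0.
  refine (is_derive_eq (is_deriveB_fun (is_derive_cst (1 : R) t (1 : R)) (is_derive_psi0 t)) _).
  by rewrite sub0r opprK.
have -> : gammaP m.+1 = fun t => gammaP m t - psi m.+1 t :> R.
  exact/funext/gammaPS.
refine (is_derive_eq (is_deriveB_fun IH (is_derive_psiS m t)) _).
by rewrite opprB subrKC.
Qed.

Lemma gammaP_at0 m : gammaP m 0 = 0 :> R.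
Proof.
elim: m => [|m IH]; first by rewrite gammaP0 psi_at0 subrr.
by rewrite gammaPS IH psi_at0 subr0.
Qed.

Lemma continuous_psi m : continuous (psi m : R -> R).
Proof.
case: m => [|m] t; apply: is_derive_continuous;
  [exact: is_derive_psi0|exact: is_derive_psiS].
Qed.

Lemma continuous_gammaP m : continuous (gammaP m : R -> R).
Proof. by move=> t; apply: is_derive_continuous; exact: is_derive_gammaP. Qed.

Lemma gammaP_le m a b : 0 <= a -> a <= b -> gammaP m a <= gammaP m b :> R.
Proof.
apply: (is_derive_nondecreasing (is_derive_gammaP m)) => x x0.
exact/psi_ge0/ltW.
Qed.

Lemma gammaP_ge0 m t : 0 <= t -> 0 <= gammaP m t.
Proof. by move=> t0; rewrite -(gammaP_at0 m) gammaP_le. Qed.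

Lemma gammaP_le1 m t : 0 <= t -> gammaP m t <= 1.
Proof.
by move=> t0; rewrite /gammaP gerBl sumr_ge0// => i _; exact: psi_ge0.
Qed.

Lemma gammaP_gt0 m t : 0 < t -> 0 < gammaP m t.
Proof.
move=> t0; have [] := @MVT R (gammaP m) (psi m) 0 t t0.
- by move=> x _; exact: is_derive_gammaP.
- by apply: continuous_subspaceT; exact: continuous_gammaP.
move=> c; rewrite in_itv/= gammaP_at0 !subr0 => /andP[c0 _] ->.
by rewrite mulr_gt0// psi_gt0.
Qed.

(** Since t psi_m = (m + 1) psi_(m+1), it is enough that psi_(m+1) = P_m - P_(m+1) is at most 1.
    This crude decay yields all the limits at infinity below. *)
Lemma psi_le m t : 0 < t -> psi m t <= m.+1%:R / t.
Proof.
move=> t0; rewrite ler_pdivlMr//.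
have -> : psi m t * t = m.+1%:R * psi m.+1 t.
  rewrite /psi factS natrM invfM exprS -!mulrA mulVKf ?pnatr_eq0//.
  by congr (_ * _); rewrite mulrA [LHS]mulrC.
rewrite ler_piMr// -subr_ge0 (le_trans (gammaP_ge0 m.+1 (ltW t0)))//.
by rewrite gammaPS lerD2r gammaP_le1// ltW.
Qed.

Lemma cvg_psi m : psi m x @[x --> +oo%R] --> (0 : R).
Proof.
apply/cvgrPdist_le => e e0; near=> x.
have x0 : 0 < x by near: x; exact: nbhs_pinfty_gt.
rewrite sub0r normrN ger0_norm ?psi_ge0 ?(ltW x0)//.
by rewrite (le_trans (psi_le m x0))// ler_pdivrMr// mulrC -ler_pdivrMr.
Unshelve. all: by end_near. Qed.

Lemma cvg_gammaP m : gammaP m x @[x --> +oo%R] --> (1 : R).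
Proof.
elim: m => [|m IH].
  have -> : gammaP 0 = fun t => 1 - psi 0 t :> R by exact/funext/gammaP0.
  by rewrite -[X in _ --> X]subr0; apply: cvgB; [exact: cvg_cst|exact: cvg_psi].
have -> : gammaP m.+1 = fun t => gammaP m t - psi m.+1 t :> R.
  exact/funext/gammaPS.
by rewrite -[X in _ --> X]subr0; apply: cvgB IH _; exact: cvg_psi.
Qed.

(* The ratio psi (m + k) / psi m is a multiple of t ^ k, hence increasing. *)
Lemma gammaP_psi_ratio m k t : 0 <= t ->
  gammaP (m + k) t * psi m t <= gammaP m t * psi (m + k) t.
Proof.
move=> t0; pose c : R := (m + k)`!%:R^-1 * m`!%:R.
have c0 : 0 <= c by rewrite mulr_ge0 ?invr_ge0.
have psiE x : psi (m + k) x = c * (x ^+ k * psi m x).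
  rewrite /psi /c exprD.
  have f0 : m`!%:R != 0 :> R by rewrite pnatr_eq0 -lt0n fact_gt0.
  rewrite -!mulrA; congr (_ * _).
  by rewrite mulrCA [X in _ = _ * X]mulrCA !mulrA mulfV// mul1r mulrAC.
(* As psi_(m+k) = c x^k psi_m, the density terms cancel in the derivative of [E], which leaves only
   the derivative of x^k, times c P_m; and [E] vanishes at 0. *)
pose E x := c * (x ^+ k * gammaP m x) - gammaP (m + k) x.
have dE (x : R) : is_derive x (1 : R) E (c * (k%:R * x ^+ k.-1 * gammaP m x)).
  refine (is_derive_eq (is_deriveB_fun (is_deriveZ_fun c (is_deriveM_fun
    (is_deriveX_fun k x) (is_derive_gammaP m x))) (is_derive_gammaP (m + k) x)) _).
  by rewrite psiE mulrDr addrK.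
have : E 0 <= E t.
  apply: (is_derive_nondecreasing dE) => // x x0.
  by rewrite !mulr_ge0 ?exprn_ge0 ?gammaP_ge0//; exact: ltW.
rewrite /E !gammaP_at0 !mulr0 subrr subr_ge0 => Et.
have := ler_wpM2r (psi_ge0 m t0) Et; rewrite psiE.
by rewrite -[c * _ * _]mulrA -[_ * gammaP m t * _]mulrA [gammaP m t * (c * _)]mulrCA
  [gammaP m t * (t ^+ k * _)]mulrCA.
Qed.

(** Monotonicity of P_m / P_n, cross-multiplied because both vanish at 0. For fixed x, the
    difference [D] of the two sides vanishes at z = x, and its derivative in z is nonnegative: P_n /
    P_m is at most psi_n / psi_m at x, and psi_n / psi_m increases from x to z. *)
Lemma gammaP_ratio m n x y : (m <= n)%N -> 0 <= x -> x <= y ->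
  gammaP m y * gammaP n x <= gammaP m x * gammaP n y.
Proof.
move=> /subnKC <-; move: (n - m)%N => k x0 xy.
rewrite le_eqVlt in x0; case/predU1P : x0 => [<-|x0].
  by rewrite !gammaP_at0 mulr0 mul0r.
pose D z := gammaP m x * gammaP (m + k) z - gammaP m z * gammaP (m + k) x.
have dD (z : R) : is_derive z (1 : R) D (gammaP m x * psi (m + k) z - psi m z * gammaP (m + k) x).
  apply: is_deriveB_fun.
    by apply: is_deriveZ_fun; exact: is_derive_gammaP.
  under eq_fun do rewrite mulrC; rewrite mulrC.
  by apply: is_deriveZ_fun; exact: is_derive_gammaP.
have : D x <= D y.
  apply: (is_derive_nondecreasing dD (c := x)) => // z xz.
  have z0 := lt_trans x0 xz.
  (* The factor [psi m x] is inserted to chain the two ratio inequalities without dividing. *)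
  rewrite subr_ge0 -(ler_pM2l (psi_gt0 m x0)).
  have rat : psi (m + k) x * psi m z <= psi (m + k) z * psi m x.
    have [x0' z0'] := (ltW x0, ltW z0).
    have xzk : x ^+ k <= z ^+ k by rewrite lerXn2r ?nnegrE// ltW.
    rewrite /psi !exprD.
    have h (a b u v p q f g : R) : 0 <= a -> 0 <= b -> 0 <= f -> 0 <= g -> 0 <= p -> 0 <= q ->
        u <= v ->
        f * (p * u * a) * (g * (q * b)) <= f * (q * v * b) * (g * (p * a)).
      move=> a0 b0 f0 g0 p0 q0 uv; rewrite -subr_ge0.
      rewrite (_ : _ - _ = f * g * a * b * p * q * (v - u)); last by ring.
      by rewrite !mulr_ge0// subr_ge0.
    by apply: h; rewrite ?expR_ge0 ?exprn_ge0 ?invr_ge0 ?ler0n.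
  have := gammaP_psi_ratio m k (ltW x0).
  move=> /(ler_wpM2r (psi_ge0 m (ltW z0))) h1.
  have := ler_wpM2l (gammaP_ge0 m (ltW x0)) rat.
  by move: h1; lra.
by rewrite /D mulrC subrr subr_ge0.
Qed.

End gamma_functions.

(** * Monotonicity in l of l \int F^2 exp(- l V), where C = V' *)

Section laplace_comparison.
Context {R : realType}.
Notation leb := (@lebesgue_measure R).
Implicit Types (t x y l m w v : R).
Variables F V C : R -> R.
Hypotheses (cF : continuous F) (cC : continuous C).
Hypothesis dV : forall t : R, is_derive t (1 : R) V (C t).
Hypothesis V0 : V 0 = 0.
Hypothesis C_ge0 : forall t, 0 <= t -> 0 <= C t.
Hypothesis C_gt0 : forall t, 0 < t -> 0 < C t.
Hypothesis C_le : forall x y, 0 <= x -> x <= y -> C x <= C y.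
Hypothesis F2C : forall x y, 0 <= x -> x <= y -> F x ^+ 2 * C y <= F y ^+ 2 * C x.

Let cV : continuous V.
Proof. by move=> t; exact: is_derive_continuous (dV t). Qed.

Let V_le x y : 0 <= x -> x <= y -> V x <= V y.
Proof. by apply: (is_derive_nondecreasing dV) => t /C_gt0/ltW. Qed.

(** V is convex on the positive half-line because C is nondecreasing there, so it lies above its
    tangent at 1. This makes V unbounded, hence onto the positive reals. *)
Lemma primitive_affine_lb t : 1 <= t -> C 1 * (t - 1) <= V t.
Proof.
move=> t1; pose D x := V x - C 1 * x.
have dD (x : R) : is_derive x (1 : R) D (C x - C 1 * 1).
  exact: (is_deriveB_fun (dV x) (is_deriveZ_fun (C 1) (is_derive_id x _))).
have : D 1 <= D t.
  apply: (is_derive_nondecreasing dD (c := 1)) => // x x1.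
  by rewrite mulr1 subr_ge0 C_le// ltW.
rewrite /D; have : 0 <= V 1 by rewrite -V0 V_le.
lra.
Qed.

Lemma primitive_cvgy : V x @[x --> +oo%R] --> +oo%R.
Proof.
apply/cvgryPge => A; near=> x.
have x1 : 1 <= x by near: x; exact: nbhs_pinfty_ge.
apply: le_trans (primitive_affine_lb x1).
rewrite mulrC -ler_pdivrMr ?C_gt0// lerBrDr.
by near: x; apply: nbhs_pinfty_ge; exact: num_real.
Unshelve. all: by end_near. Qed.

Lemma primitive_onto v : 0 < v -> exists2 t, 0 < t & V t = v.
Proof.
(* The time at which the affine lower bound reaches v. *)
move=> v0; pose T := 1 + v / C 1.
have T1 : 1 <= T by rewrite lerDl divr_ge0// ltW// C_gt0.
have VT : v <= V T.
  apply: le_trans (primitive_affine_lb T1).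
  by rewrite /T [1 + _]addrC addrK mulrC divfK// gt_eqF// C_gt0.
have T0 : 0 <= T by exact: le_trans T1.
have [//||t] := @IVT R V 0 T v T0.
- exact: continuous_subspaceT.
- by rewrite V0 minElt maxElt; have := VT; case: ltP => /= *; apply/andP; split => //; lra.
rewrite in_itv/= => /andP[t0 _] Vt; exists t => //.
by rewrite lt_neqAle t0 andbT; apply/eqP => t00; move: Vt; rewrite -t00 V0; lra.
Qed.

(** With the new variable V t this is w times the total mass of an exponential law. The value does
    not depend on l, so two such integrals can be added to the two sides of a comparison. *)
Lemma integral_exp_primitive w l : 0 <= w -> 0 < l ->
  (\int[leb]_(t in `[0%R, +oo[) (w * (C t * (l * expR (- (l * V t)))))%:E = w%:E)%E.
Proof.
move=> w0 l0; pose H t := - w * expR (- (l * V t)).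
have dH (t : R) : is_derive t (1 : R) H (w * (C t * (l * expR (- (l * V t))))).
  refine (is_derive_eq (is_deriveZ_fun (- w) (is_derive_comp_fun (is_derive_expR _)
    (is_deriveN_fun (is_deriveZ_fun l (dV t))))) _).
  by move: (expR _) => e; ring.
have cH : continuous H by move=> t; exact: is_derive_continuous (dH t).
rewrite (@ge0_continuous_FTC2y R _ H 0 0).
- by rewrite /H V0 mulr0 oppr0 expR0 mulr1 sub0e EFinN oppeK.
- move=> t t0; rewrite !mulr_ge0// ?expR_ge0 ?C_ge0//; exact: ltW.
- apply: continuous_subspaceT => t.
  apply: cvgM; first exact: cvg_cst.
  apply: cvgM; first exact: cC.
  apply: cvgM; first exact: cvg_cst.
  apply: (cvg_comp _ expR); last exact: continuous_expR.
  by apply: cvgN; apply: cvgM; [exact: cvg_cst|exact: cV].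
- rewrite /H -[X in _ --> X](mulr0 (- w)); apply: cvgM; first exact: cvg_cst.
  apply: (@cvg_comp _ _ _ (fun t => l * V t) (fun x => expR (- x)) _ +oo%R); last exact: cvgr_expR.
  by apply: gt0_cvgMry => //; exact: primitive_cvgy.
- by move=> t _; case: (dH t).
- exact/cvg_at_right_filter/cH.
- by move=> t _; exact: is_derive_derive1.
Qed.

(* Single crossing: with W = F^2 / V', which is nondecreasing, the function
   m exp (- m v) - l exp (- l v) changes sign once, at v = V s, and its
   integral against V' vanishes, so its integral against F^2 = W V' is at most
   W s times zero. *)
Lemma laplace_transform_nincr l m : 0 < l -> l <= m ->
  (\int[leb]_(t in `[0%R, +oo[) (m * (F t ^+ 2 * expR (- (m * V t))))%:E <=
   \int[leb]_(t in `[0%R, +oo[) (l * (F t ^+ 2 * expR (- (l * V t))))%:E)%E.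
Proof.
move=> l0; rewrite le_eqVlt => /predU1P[->//|lm].
have m0 := lt_trans l0 lm.
have ml0 : 0 < m - l by rewrite subr_gt0.
(* The point where the exponential densities of rates l and m cross: m exp(- m v) = l exp(- l v). *)
pose v := ln (m / l) / (m - l).
have v0 : 0 < v.
  by rewrite /v divr_gt0// ln_gt0// ltr_pdivlMr// mul1r.
have mE : m = l * expR ((m - l) * v).
  rewrite /v [(m - l) * _]mulrC divfK ?gt_eqF// lnK ?posrE ?divr_gt0//.
  by rewrite mulrC divfK ?gt_eqF.
have [s s0 Vs] := primitive_onto v0.
have Cs0 := C_gt0 s0.
pose w := F s ^+ 2 / C s.
have w0 : 0 <= w by rewrite divr_ge0 ?sqr_ge0 ?ltW.
have cexp (k : R) : continuous (fun t => expR (- (k * V t))).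
  move=> t; apply: (cvg_comp _ expR); last exact: continuous_expR.
  by apply: cvgN; apply: cvgM; [exact: cvg_cst|exact: cV].
have mA (k : R) : measurable_fun [set: R] (fun t => k * (F t ^+ 2 * expR (- (k * V t)))).
  apply: continuous_measurable_fun => t.
  apply: cvgM; first exact: cvg_cst.
  apply: cvgM; last exact: cexp.
  by rewrite expr2; under eq_fun do rewrite expr2; apply: cvgM; exact: cF.
have mB (k : R) : measurable_fun [set: R] (fun t => w * (C t * (k * expR (- (k * V t))))).
  apply: continuous_measurable_fun => t.
  apply: cvgM; first exact: cvg_cst.
  apply: cvgM; first exact: cC.
  by apply: cvgM; [exact: cvg_cst|exact: cexp].
have A0 (k : R) t : 0 < k -> (`[0, +oo[%classic : set R) t ->
    (0 <= (k * (F t ^+ 2 * expR (- (k * V t))))%:E)%E.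
  by move=> k0 _; rewrite lee_fin mulr_ge0 ?(ltW k0)// mulr_ge0 ?sqr_ge0 ?expR_ge0.
have B0 (k : R) t : 0 < k -> (`[0, +oo[%classic : set R) t ->
    (0 <= (w * (C t * (k * expR (- (k * V t)))))%:E)%E.
  move=> k0; rewrite /= in_itv/= andbT => t0.
  by rewrite lee_fin mulr_ge0// mulr_ge0 ?C_ge0// mulr_ge0 ?expR_ge0 ?(ltW k0).
(* The same w is added to both sides, written with rate l on the left and rate m on the right. Every
   integrand stays nonnegative, so the comparison becomes pointwise without any integrability of F^2
   exp(- l V). *)
rewrite -(@leeD2rE _ w%:E); last by [].
rewrite -{1}(integral_exp_primitive w0 l0) -(integral_exp_primitive w0 m0).
have mE' (f : R -> R) : measurable_fun [set: R] f ->
    measurable_fun (`[0, +oo[%classic : set R) (EFin \o f).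
  by move=> mf; exact/measurable_EFinP/measurable_funTS.
have mA' k := mE' _ (mA k); have mB' k := mE' _ (mB k).
rewrite -!ge0_integralD//; try by move=> *;
  (exact: A0 || exact: B0 || exact: mA' || exact: mB').
apply: ge0_le_integral => //.
- by move=> t t0; rewrite adde_ge0 ?A0 ?B0.
- by apply: emeasurable_funD; [exact: mA'|exact: mB'].
- by apply: emeasurable_funD; [exact: mA'|exact: mB'].
move=> t; rewrite /= in_itv/= andbT => t0.
rewrite -!EFinD lee_fin -subr_ge0.
rewrite (_ : _ - _ = (w * C t - F t ^+ 2) *
  (m * expR (- (m * V t)) - l * expR (- (l * V t)))); last first.
  by move: (expR _) (expR _) => e1 e2; ring.
have kE : m * expR (- (m * V t)) - l * expR (- (l * V t)) =
    l * (expR ((m - l) * v - m * V t) - expR (- (l * V t))).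
  by rewrite {1}mE -mulrA -expRD -mulrBr.
have [ts|st] := leP t s.
  have Vts : V t <= v by rewrite -Vs V_le.
  apply: mulr_ge0.
    by rewrite subr_ge0 /w mulrAC ler_pdivlMr// F2C.
  rewrite kE mulr_ge0 ?(ltW l0)// subr_ge0 ler_expR.
  by have := ler_wpM2l (ltW ml0) Vts; lra.
have Vts : v <= V t by rewrite -Vs V_le// ltW.
apply: mulr_le0.
  by rewrite subr_le0 /w mulrAC ler_pdivrMr// F2C// ltW.
rewrite kE mulr_ge0_le0 ?(ltW l0)// subr_le0 ler_expR.
by have := ler_wpM2l (ltW ml0) Vts; lra.
Qed.

End laplace_comparison.

(** * Integration against a measure with a density *)

Section density.
Context d (T : measurableType d) (R : realType).
Variables (mu nu : {measure set T -> \bar R}) (p : T -> R).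
Hypotheses (mp : measurable_fun setT p) (p_ge0 : forall x, 0 <= p x).
Hypothesis nuE : forall A, measurable A -> nu A = (\int[mu]_(x in A) (p x)%:E)%E.
Local Open Scope ereal_scope.
Import HBNNSimple.

Let mpE : measurable_fun setT (EFin \o p).
Proof. exact/measurable_EFinP. Qed.

Let integral_density_nnsfun (h : {nnsfun T >-> R}) :
  \int[nu]_x (h x)%:E = \int[mu]_x ((h x)%:E * (p x)%:E).
Proof.
under [LHS]eq_integral do rewrite fimfunE -fsumEFin//.
rewrite [LHS]ge0_integral_fsum//; last 2 first.
  - by move=> r; exact/measurable_EFinP/measurableT_comp.
  - by move=> n x _; rewrite EFinM nnfun_muleindic_ge0.
under [RHS]eq_integral.
  move=> x xD; rewrite fimfunE -fsumEFin// ge0_mule_fsuml; last first.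
    by move=> r; rewrite EFinM nnfun_muleindic_ge0.
  over.
rewrite [RHS]ge0_integral_fsum//; last 2 first.
  - move=> r; apply: emeasurable_funM => //.
    exact/measurable_EFinP/measurableT_comp.
  - move=> n x _; rewrite EFinM mule_ge0//; first by rewrite nnfun_muleindic_ge0.
    by rewrite lee_fin.
apply: eq_fsbigr => r rh.
under [LHS]eq_integral do rewrite EFinM.
rewrite integralZl_indic_nnsfun//= integral_indic// setIT nuE//.
under [RHS]eq_integral do rewrite EFinM -muleA.
rewrite ge0_integralZl//.
- congr (_ * _); rewrite integral_mkcond; apply: eq_integral => x _.
  by rewrite epatch_indic muleC.
- by apply: emeasurable_funM => //; exact/measurable_EFinP/measurable_indic.
- by move=> x _; rewrite mule_ge0// lee_fin.
- by move: rh; rewrite inE => -[t _ <-]; rewrite lee_fin.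
Qed.

Lemma ge0_integral_density (f : T -> \bar R) : measurable_fun setT f ->
  (forall x, 0 <= f x) -> \int[nu]_x f x = \int[mu]_x (f x * (p x)%:E).
Proof.
move=> mf f0; pose h := nnsfun_approx measurableT mf.
transitivity (lim (\int[nu]_x (h n x)%:E @[n --> \oo])).
  rewrite -monotone_convergence//=.
  - apply: eq_integral => x _; apply/esym/cvg_lim => //=.
    exact: cvg_nnsfun_approx.
  - by move=> n; exact/measurable_EFinP/measurable_funTS.
  - by move=> n ? _; rewrite lee_fin.
  - by move=> ? _ ? ? mn; rewrite lee_fin; exact/lefP/nd_nnsfun_approx.
transitivity (lim (\int[mu]_x ((h n x)%:E * (p x)%:E) @[n --> \oo])).
  by apply: congr_lim; apply/funext => n; exact: integral_density_nnsfun.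
rewrite -monotone_convergence//=.
- apply: eq_integral => x _; apply/cvg_lim => //=.
  by apply: cvgeZr => //; exact: cvg_nnsfun_approx.
- move=> n; apply: emeasurable_funM => //.
  exact/measurable_EFinP/measurable_funTS.
- by move=> n x _; rewrite mule_ge0// lee_fin.
- move=> x _ a b ab; rewrite lee_wpmul2r ?lee_fin//.
  exact/lefP/nd_nnsfun_approx.
Qed.

End density.

(** * Second moment and symmetry of the centered normal law *)

Section normal_moments.
Context {R : realType}.
Notation leb := (@lebesgue_measure R).
Implicit Types (s x : R).

Lemma is_derive_normal_pdf s x : s != 0 ->
  is_derive x 1 (normal_pdf 0 s) (- (x / s ^+ 2) * normal_pdf 0 s x).
Proof.
move=> s0; rewrite normal_pdfE//.
have dq : is_derive x 1 (fun t : R => - (t - 0) ^+ 2 / (s ^+ 2 *+ 2)) (- (x / s ^+ 2)).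
  have -> : (fun t : R => - (t - 0) ^+ 2 / (s ^+ 2 *+ 2)) =
      (fun t => (- (s ^+ 2 *+ 2)^-1) * (t ^+ 2)).
    by apply/funext => t; rewrite subr0 mulrC mulrN mulNr.
  refine (is_derive_eq (is_deriveZ_fun _ (is_deriveX_fun 2 x)) _).
  rewrite expr1 -mulr_natr; have s2 : s ^+ 2 != 0 by rewrite expf_neq0.
  by move: (s ^+ 2) s2 => u u0; field.
refine (is_derive_eq (is_deriveZ_fun (normal_peak s)
  (is_derive_comp_fun (is_derive_expR _) dq)) _).
by rewrite mulrA mulrC -/(normal_fun 0 s x).
Qed.

Lemma integral0y_normal_pdf s : s != 0 ->
  (\int[leb]_(x in `[0%R, +oo[) (normal_pdf 0 s x)%:E = (2^-1)%:E)%E.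
Proof.
move=> s0; have := integral_normal_pdf 0 s.
rewrite ge0_symfun_integralT//; first last.
- by move=> x; rewrite normal_pdfE//= /normal_fun !subr0 sqrrN.
- exact: continuous_normal_pdf.
- exact: normal_pdf_ge0.
rewrite (_ : [set x | _] = `[0%R, +oo[%classic); last first.
  by apply/seteqP; split => x/=; rewrite in_itv/= andbT.
move/(congr1 (fun e => (2^-1)%:E * e)%E).
by rewrite muleA -EFinM mulVf// mul1e mule1.
Qed.

Lemma cvg_id_normal_pdf s : 0 < s -> x * normal_pdf 0 s x @[x --> +oo%R] --> (0 : R).
Proof.
move=> s0; have sn0 : s != 0 by rewrite gt_eqF.
apply/cvgrPdist_le => e e0; near=> x.
have x0 : 0 < x by near: x; exact: nbhs_pinfty_gt.
rewrite sub0r normrN ger0_norm ?mulr_ge0 ?normal_pdf_ge0 ?(ltW x0)//.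
rewrite normal_pdfE// /normal_fun subr0.
pose y := x ^+ 2 / (s ^+ 2 *+ 2).
have y0 : 0 < y by rewrite divr_gt0 ?exprn_gt0// mulrn_wgt0// exprn_gt0.
have -> : - x ^+ 2 / (s ^+ 2 *+ 2) = - y by rewrite mulNr.
have ey : expR (- y) <= y^-1.
  rewrite expRN lef_pV2 ?posrE ?expR_gt0//.
  by rewrite (le_trans _ (expR_ge1Dx _))// lerDr.
apply: (@le_trans _ _ (x * (normal_peak s * y^-1))).
  by rewrite ler_wpM2l ?(ltW x0)// ler_wpM2l ?normal_peak_ge0.
rewrite (_ : x * _ = normal_peak s * (s ^+ 2 *+ 2) / x); last first.
  rewrite /y; have x0' : x != 0 by rewrite gt_eqF.
  have s20 : s ^+ 2 *+ 2 != 0 by rewrite mulrn_eq0/= sqrf_eq0.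
  by move: (s ^+ 2 *+ 2) s20 (normal_peak s) => u u0 v; field; rewrite x0' u0.
by rewrite ler_pdivrMr// [e * x]mulrC -ler_pdivrMr.
Unshelve. all: by end_near. Qed.

(** From p' = - (x / s^2) p one gets x^2 p = s^2 p - (s^2 x p)'. Integrating over [0, n] reduces the
    claim to the mass 1/2 of the half-line and to a boundary term tending to 0. *)
Lemma integral0y_sqr_normal_pdf s : 0 < s ->
  (\int[leb]_(x in `[0%R, +oo[) (x ^+ 2 * normal_pdf 0 s x)%:E = (s ^+ 2 / 2)%:E)%E.
Proof.
move=> s0; have sn0 : s != 0 by rewrite gt_eqF.
pose p := normal_pdf 0 s; pose q (x : R) := x ^+ 2 * p x.
have cp : continuous p by exact: continuous_normal_pdf.
have cq : continuous q.
  by move=> x; apply: cvgM; [exact: exprn_continuous|exact: cp].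
pose Q (x : R) := s ^+ 2 * (x * p x).
have dQ (x : R) : is_derive x (1 : R) Q (s ^+ 2 * p x - q x).
  refine (is_derive_eq (is_deriveZ_fun _ (is_deriveM_fun (is_derive_id x (1 : R))
    (is_derive_normal_pdf x sn0))) _).
  rewrite -/p /q; have s2 : s ^+ 2 != 0 by rewrite expf_neq0.
  by move: (s ^+ 2) s2 (p x) => u u0 v; field.
have ce : continuous (fun x => s ^+ 2 * p x - q x).
  move=> x; apply: cvgB; last exact: cq.
  by apply: cvgM; [exact: cvg_cst|exact: cp].
have csp : continuous (fun x => s ^+ 2 * p x).
  by move=> x; apply: cvgM; [exact: cvg_cst|exact: cp].
have qE n : \int[leb]_(x in `[0, n%:R]) q x =
    s ^+ 2 * \int[leb]_(x in `[0, n%:R]) p x - Q n%:R.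
  have := Rintegral_is_derive (ler0n R n) ce dQ.
  rewrite RintegralB//; [|exact: integrable_continuous..].
  rewrite RintegralZl//; last exact: integrable_continuous.
  by rewrite [Q 0]/Q mul0r mulr0 subr0 => <-; rewrite opprB addrC subrK.
have q0 x : 0 <= q x by rewrite mulr_ge0 ?sqr_ge0 ?normal_pdf_ge0.
have /cvg_lim <- // := @ge0_cvgn_integral R leb q q0 (continuous_measurable_fun cq).
apply/cvg_lim => //.
under eq_fun do rewrite (EFin_Rintegral_continuous _ _ cq).
apply/cvg_EFin; first exact: nearW.
rewrite (_ : fine \o _ = (fun n => s ^+ 2 * \int[leb]_(x in `[0, n%:R]) p x - Q n%:R)); last first.
  exact/funext.
rewrite -[X in _ --> X]subr0; apply: cvgB; last first.
  rewrite -(mulr0 (s ^+ 2)); apply: cvgM; first exact: cvg_cst.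
  by apply: (cvg_comp _ _ _ (cvg_id_normal_pdf s0)); exact: cvgr_idn.
apply: cvgM; first exact: cvg_cst.
have := @ge0_cvgn_integral R leb p (@normal_pdf_ge0 _ _ _) (@measurable_normal_pdf _ _ _).
rewrite integral0y_normal_pdf//.
by move/fine_cvgP => -[_]; apply: cvg_trans; apply: near_eq_cvg; exact: nearW.
Qed.

Lemma integral_sqr_normal_prob s : 0 < s ->
  (\int[normal_prob 0 s]_x (x ^+ 2)%:E = (s ^+ 2)%:E)%E.
Proof.
move=> s0; have sn0 : s != 0 by rewrite gt_eqF.
rewrite (@ge0_integral_density _ _ _ leb _ (normal_pdf 0 s))//; first last.
- by move=> x; rewrite lee_fin sqr_ge0.
- by apply/measurable_EFinP; exact: exprn_measurable.
- exact: normal_pdf_ge0.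
- exact: measurable_normal_pdf.
under eq_integral do rewrite -EFinM.
rewrite ge0_symfun_integralT//; first last.
- by move=> x; rewrite normal_pdfE//= /normal_fun !subr0 sqrrN.
- move=> x; apply: cvgM; first exact: exprn_continuous.
  exact: continuous_normal_pdf.
- by move=> x; rewrite mulr_ge0 ?sqr_ge0 ?normal_pdf_ge0.
rewrite (_ : [set x | _] = `[0%R, +oo[%classic); last first.
  by apply/seteqP; split => x/=; rewrite in_itv/= andbT.
by rewrite integral0y_sqr_normal_pdf// -EFinM mulrC divfK.
Qed.

(** The density is even. This symmetry gives the zero mean later, with no first moment to
    compute. *)
Lemma normal_prob_opp s (A : set R) : s != 0 -> measurable A ->
  pushforward (normal_prob 0 s) -%R A = normal_prob 0 s A.
Proof.
move=> s0 mA; rewrite /pushforward /normal_prob.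
have mN : measurable (-%R @^-1` A : set R).
  by rewrite -[X in measurable X]setTI; exact: (@oppr_measurable R setT measurableT _ mA).
transitivity (\int[leb]_(x in ((-%R : _ -> measurableTypeR R) @^-1` A))
    (((fun x => (normal_pdf 0 s x)%:E) \o -%R) x))%E.
  by apply: eq_integral => x _ /=; rewrite normal_pdfE// /normal_fun !subr0 sqrrN.
rewrite -ge0_integral_pushforward//=.
- by apply: eq_measure_integral => //= B mB BA; exact: lebesgue_measureN.
- by apply/measurable_EFinP/measurable_funTS; exact: measurable_normal_pdf.
- by move=> x _; rewrite lee_fin normal_pdf_ge0.
Qed.

End normal_moments.

(** * Square integrable functions and products of independent variables *)

Section square_integrable.
Context d (T : measurableType d) (R : realType).
Variable mu : {measure set T -> \bar R}.
Implicit Types f g : T -> R.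

Definition square_integrable f := measurable_fun setT f /\
  mu.-integrable setT (fun w => (f w ^+ 2)%:E).

(** Domination by f^2 + g^2. *)
Lemma square_integrableM f g : square_integrable f -> square_integrable g ->
  mu.-integrable setT (fun w => (f w * g w)%:E).
Proof.
move=> [mf if2] [mg ig2].
apply: le_integrable (integrableD measurableT if2 ig2) => //.
  by apply/measurable_EFinP; exact: measurable_funM.
move=> w _ /=; rewrite lee_fin [leRHS]ger0_norm ?addr_ge0 ?sqr_ge0//.
rewrite ler_norml; have := sqr_ge0 (f w + g w); have := sqr_ge0 (f w - g w).
rewrite sqrrB sqrrD; have := sqr_ge0 (f w); have := sqr_ge0 (g w).
by move: (f w ^+ 2) (g w ^+ 2) (f w * g w) => a b c *; apply/andP; split; lra.
Qed.

Lemma square_integrableD f g : square_integrable f -> square_integrable g ->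
  square_integrable (fun w => f w + g w).
Proof.
move=> Lf Lg; have [mf if2] := Lf; have [mg ig2] := Lg.
split; first exact: measurable_funD.
have ifg := integrableZl measurableT 2 (square_integrableM Lf Lg).
have := integrableD measurableT (integrableD measurableT if2 ig2) ifg.
by apply: eq_integrable => // w _ /=; rewrite -EFinM -!EFinD; congr EFin; ring.
Qed.

Lemma square_integrableZ k f : square_integrable f ->
  square_integrable (fun w => k * f w).
Proof.
move=> [mf if2]; split; first exact: measurable_funM.
have := integrableZl measurableT (k ^+ 2) if2.
by apply: eq_integrable => // w _ /=; rewrite exprMn EFinM.
Qed.

End square_integrable.

Section square_integrable_probability.
Context d (T : measurableType d) (R : realType) (P : probability T R).

Lemma square_integrable_cst (k : R) : square_integrable P (cst k).
Proof. by split => //; exact: (@finite_measure_integrable_cst _ _ _ P setT (k ^+ 2) measurableT). Qed.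

Lemma square_integrable_integrable (f : T -> R) :
  square_integrable P f -> P.-integrable setT (EFin \o f).
Proof.
move=> Lf; have := square_integrableM Lf (square_integrable_cst 1).
by apply: eq_integrable => // w _ /=; rewrite mulr1.
Qed.

(** Repackages a measurable function as a random variable, so that [distribution] applies to it. *)
Definition random_variable_of (X : T -> R) (mX : measurable_fun setT X) : {RV P >-> R} :=
  HB.pack_for {RV P >-> R} X (isMeasurableFun.Build _ _ _ _ X mX).

(** Independence says that the joint law agrees with the product of the marginals on rectangles,
    hence everywhere; the claim is then Fubini for the product of the coordinates. *)
Lemma Rintegral_indepM (X Y : T -> R) :
  square_integrable P X -> square_integrable P Y ->
  (forall A C, measurable A -> measurable C ->
    P (X @^-1` A `&` Y @^-1` C) = (P (X @^-1` A) * P (Y @^-1` C))%E) ->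
  \int[P]_w (X w * Y w) = (\int[P]_w X w) * (\int[P]_w Y w).
Proof.
move=> LX LY indXY; have [[mX _] [mY _]] := (LX, LY).
have iX := square_integrable_integrable LX.
have iY := square_integrable_integrable LY.
have iXY := square_integrableM LX LY.
pose X' : {RV P >-> R} := random_variable_of mX.
pose Y' : {RV P >-> R} := random_variable_of mY.
pose XY w := (X w, Y w).
have mXY : measurable_fun setT XY by exact: measurable_fun_pair.
pose f (z : R * R) := (z.1 * z.2)%:E.
have mf : measurable_fun setT f by apply/measurable_EFinP; exact: measurable_funM.
have prodE A : measurable A ->
    pushforward P XY A = (distribution P X' \x distribution P Y')%E A.
  move=> mA; apply/esym; move: A mA; apply: product_measure_unique => A C mA mC.
  by rewrite /pushforward/= /pushforward/= -indXY.
have intf : (distribution P X' \x distribution P Y')%E.-integrable setT f.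
  have : (pushforward P XY).-integrable setT f by exact: integrable_pushforward.
  move=> /integrableP[_ h]; apply/integrableP; split => //.
  apply: le_lt_trans h; rewrite le_eqVlt; apply/orP; left; apply/eqP.
  by apply: eq_measure_integral => A mA _; exact/esym/prodE.
have hX : (\int[distribution P X']_x x%:E = (\int[P]_w X w)%:E)%E.
  rewrite integral_distribution//= /Rintegral fineK//.
  exact: integrable_fin_num.
have hY : (\int[distribution P Y']_x x%:E = (\int[P]_w Y w)%:E)%E.
  rewrite integral_distribution//= /Rintegral fineK//.
  exact: integrable_fin_num.
have idX : (distribution P X').-integrable setT EFin.
  exact: integrable_pushforward.
have idY : (distribution P Y').-integrable setT EFin.
  exact: integrable_pushforward.
rewrite {1}/Rintegral.
have -> : (\int[P]_w (X w * Y w)%:E = \int[pushforward P XY]_z f z)%E.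
  by rewrite integral_pushforward// preimage_setT.
rewrite (eq_measure_integral (distribution P X' \x distribution P Y')%E); last first.
  by move=> A mA _; exact: prodE.
rewrite -integral12_prod_meas1// /fubini_F /f/=.
under eq_integral do (under eq_integral do rewrite EFinM; rewrite integralZl// hY).
by rewrite integralZr//= hX.
Qed.

End square_integrable_probability.

(** * Moments of variables with a prescribed normal law *)

Section normal_law.
Context {R : realType} d (T : measurableType d) (P : probability T R).
Variables (X : T -> R) (v : R).
Hypotheses (mX : measurable_fun setT X) (v0 : 0 <= v).
Hypothesis lawX : has_normal_law P X 0 v.

Let integral_law_sqr : (\int[P]_w (X w ^+ 2)%:E = v%:E)%E.
Proof.
have mf : measurable_fun [set: R] (fun x : R => (x ^+ 2)%:E).
  by apply/measurable_EFinP; exact: exprn_measurable.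
have f0 (x : R) : (0 <= (x ^+ 2)%:E)%E by rewrite lee_fin sqr_ge0.
pose X' : {RV P >-> measurableTypeR R} :=
  HB.pack_for {RV P >-> measurableTypeR R} X (isMeasurableFun.Build _ _ _ (measurableTypeR R) X mX).
transitivity (\int[distribution P X']_x (x ^+ 2)%:E)%E.
  by rewrite ge0_integral_distribution.
(* A zero variance stands for a Dirac mass in [has_normal_law]. The case does occur: the initial
   part has variance 0 at tau = 0. *)
have [v00|vn0] := eqVneq v 0.
  rewrite (@eq_measure_integral _ _ _ _ (@dirac _ (measurableTypeR R) (0 : R) R)).
    by rewrite integral_dirac//= diracT mul1e expr0n/= v00.
  move=> A mA _; transitivity (P (X @^-1` A)) => //.
  by rewrite (lawX mA) v00 eqxx.
have v1 : 0 < v by rewrite lt_neqAle eq_sym vn0.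
rewrite (@eq_measure_integral _ _ _ _ (normal_prob 0 (Num.sqrt v))).
  by rewrite integral_sqr_normal_prob ?sqrtr_gt0// sqr_sqrtr.
move=> A mA _; transitivity (P (X @^-1` A)) => //.
by rewrite (lawX mA) (negbTE vn0).
Qed.

Lemma normal_law_integrable_sqr :
  P.-integrable setT (fun w => (X w ^+ 2)%:E).
Proof.
apply/integrableP; split.
  by apply/measurable_EFinP; exact: measurable_funX.
under eq_integral do rewrite gee0_abs ?lee_fin ?sqr_ge0//.
by rewrite integral_law_sqr ltry.
Qed.

Lemma normal_law_second_moment : \int[P]_w (X w ^+ 2) = v.
Proof. by rewrite /Rintegral integral_law_sqr. Qed.

Lemma normal_law_L2 : square_integrable P X.
Proof. by split => //; exact: normal_law_integrable_sqr. Qed.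

(** X and - X have the same law, so the mean equals its opposite. *)
Lemma normal_law_mean : \int[P]_w X w = 0.
Proof.
have iX : P.-integrable setT (EFin \o X).
  exact/square_integrable_integrable/normal_law_L2.
have mNX : measurable_fun setT (fun w => - X w) by exact: measurable_funN.
have symX (A : set R) : measurable A -> pushforward P X A = pushforward P (fun w => - X w) A.
  move=> mA; rewrite /pushforward lawX//.
  have mNA : measurable (-%R @^-1` A : set R).
    by rewrite -[X in measurable X]setTI; exact: (@oppr_measurable R setT measurableT _ mA).
  rewrite -[(fun w => - X w) @^-1` A]/(X @^-1` (-%R @^-1` A)) lawX//.
  have [_|v00] := eqVneq v 0.
    have E0 : (0 \in (-%R @^-1` A : set R)) = (0 \in A).
      by apply/idP/idP; rewrite !inE/= oppr0.
    by rewrite !diracE E0.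
  by rewrite -normal_prob_opp// sqrtr_eq0 -ltNge lt_neqAle eq_sym v00.
have : (\int[P]_w (X w)%:E = \int[P]_w (- X w)%:E)%E.
  transitivity (\int[distribution P (random_variable_of P mX)]_x x%:E)%E.
    by rewrite integral_distribution.
  transitivity (\int[distribution P (random_variable_of P mNX)]_x x%:E)%E.
    by apply: eq_measure_integral => A mA _; exact: symX.
  rewrite integral_distribution//=.
  have := integrableN iX; apply: eq_integrable => //.
move/(congr1 fine); rewrite -[LHS]/(\int[P]_w X w) -[RHS]/(\int[P]_w (- X w)).
under [RHS]eq_Rintegral do rewrite -mulN1r.
rewrite RintegralZl// mulN1r => /eqP.
by rewrite -subr_eq0 opprK -mulr2n mulrn_eq0/= => /eqP.
Qed.

End normal_law.

(** * Joint measurability of continuous processes *)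

Section caratheodory.
Context d (T : measurableType d) (R : realType).
Variable H : R -> T -> R.
Hypothesis mH : forall s, measurable_fun setT (H s).
Hypothesis cH : forall w, {within `[0, +oo[, continuous (H ^~ w)}.

(** Rounds s down to the mesh 1 / (n + 1). [Num.truncn] is 0 on negative numbers, so negative times
    are sent to 0 and the limit is [Num.max 0 s]. *)
Let grid n (s : R) : R := (Num.truncn (n.+1%:R * s))%:R / n.+1%:R.

Let grid_cvg (s : R) :
  grid n s @[n --> \oo] --> within `[0, +oo[%classic (nbhs (Num.max 0 s)).
Proof.
have grid_nbhs : grid n s @[n --> \oo] --> Num.max 0 s.
  apply/cvgrPdist_le => e e0; near=> n.
  have n0 : (0 : R) < n.+1%:R by [].
  apply: (@le_trans _ _ n.+1%:R^-1); last first.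
    by apply: ltW; near: n; exact: (near_infty_natSinv_lt (PosNum e0)).
  rewrite /grid; have [s0|s0] := leP 0 s.
    have /andP[t1 t2] := truncn_itv (mulr_ge0 (ltW n0) s0).
    rewrite (_ : s - _ = (n.+1%:R * s - (Num.truncn (n.+1%:R * s))%:R) / n.+1%:R); last first.
      by rewrite mulrBl mulrAC mulfV ?gt_eqF// mul1r.
    rewrite normrM normfV [X in _ / X]gtr0_norm// ler_pdivrMr// mulVf ?gt_eqF//.
    by rewrite ger0_norm ?subr_ge0// lerBlDl natr1 ltW.
  have -> : Num.truncn (n.+1%:R * s) = 0%N.
    by rewrite truncn_floor ifN// -ltNge pmulr_rlt0.
  by rewrite mul0r subrr normr0 invr_ge0.
move=> U /= hU; have := grid_nbhs _ hU.
apply: (@filterS _ \oo) => n; apply.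
by rewrite /= in_itv/= andbT divr_ge0.
Unshelve. all: by end_near. Qed.

Let measurable_grid n : measurable_fun setT (fun z : measurableTypeR R * T => H (grid n z.1) z.2).
Proof.
move=> _ Y mY; rewrite setTI.
pose c k : R := k%:R / n.+1%:R.
have mtr : measurable_fun setT (fun s : R => (Num.truncn (n.+1%:R * s))%:R : R).
  apply: nondecreasing_measurable => // x y xy.
  by rewrite ler_nat le_truncn// ler_wpM2l.
have -> : (fun z : measurableTypeR R * T => H (grid n z.1) z.2) @^-1` Y =
    \bigcup_k (((fun s : R => (Num.truncn (n.+1%:R * s))%:R : R) @^-1` [set k%:R])
      `*` (H (c k) @^-1` Y)).
  apply/seteqP; split => [[s w]/= Yw|[s w]/= [k _ [/= sk Yw]]].
    by exists (Num.truncn (n.+1%:R * s)).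
  by rewrite /grid sk.
apply: bigcup_measurable => k _; apply: measurableX.
  by rewrite -[X in measurable X]setTI; exact: mtr.
by rewrite -[X in measurable X]setTI; exact: mH.
Qed.

(** Path continuity makes the process a pointwise limit of its values on the grid, and those are
    jointly measurable, their preimages being countable unions of rectangles. Continuity is given on
    [0, +oo[ only, hence the truncation of time. *)
Lemma measurable_continuous_process :
  measurable_fun setT (fun z : measurableTypeR R * T => H (Num.max 0 z.1) z.2).
Proof.
apply: (measurable_fun_cvg measurable_grid) => -[s w] _ /=.
have m0 : (`[0, +oo[%classic : set R) (Num.max 0 s).
  by rewrite /= in_itv/= andbT le_max lexx.
have /subspace_continuousP /(_ _ m0) := @cH w.
by apply: cvg_comp; exact: grid_cvg.
Qed.

End caratheodory.

(** * Moments of time integrals of a process, by Fubini *)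

Section time_integral.
Context d (T : measurableType d) (R : realType) (P : probability T R).
Notation leb := (@lebesgue_measure R).
Variables (H : R -> T -> R) (tau M : R).
Hypothesis mH : forall s, measurable_fun setT (H s).
Hypothesis cH : forall w, {within `[0, +oo[, continuous (H ^~ w)}.
Hypothesis tau0 : 0 <= tau.
Hypothesis LH : forall s, 0 <= s -> s <= tau -> square_integrable P (H s).
Hypothesis HM : forall s, 0 <= s -> s <= tau -> \int[P]_w (H s w ^+ 2) <= M.

Let D : set (measurableTypeR R) := `[0, tau]%classic.

Let mD : measurable D. Proof. exact: measurable_itv. Qed.

Let cHD w : {within D, continuous (H ^~ w)}.
Proof. by apply: continuous_subspaceW (@cH w); exact: subset_itvl. Qed.

Let iHD w : leb.-integrable D (EFin \o H ^~ w).
Proof. by apply: continuous_compact_integrable (@cHD w); exact: segment_compact. Qed.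

Let iH2D w : leb.-integrable D (fun s => (H s w ^+ 2)%:E).
Proof.
apply: continuous_compact_integrable; first exact: segment_compact.
move=> s; apply: (@continuous_comp _ _ _ (H ^~ w : subspace D -> R) (fun x => x ^+ 2)).
  exact: cHD.
exact: exprn_continuous.
Qed.

Definition time_integral w := \int[leb]_(s in D) H s w.

(** Extension by zero outside [0, tau]: double integrals then range over the whole product space,
    and joint measurability is inherited from the truncated process. *)
Let ext (s : R) w : R := \1_D s * H (Num.max 0 s) w.

Let mext : measurable_fun setT (fun z : measurableTypeR R * T => ext z.1 z.2).
Proof.
apply: measurable_funM; last exact: measurable_continuous_process.
by apply: measurableT_comp => //; exact: measurable_indic.
Qed.

Let extE s w : D s -> ext s w = H s w.
Proof.
move=> Ds; rewrite /ext indicE mem_set// mul1r max_r//.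
by move: Ds; rewrite /D/= in_itv/= => /andP[].
Qed.

Let ext0 s w : ~ D s -> ext s w = 0.
Proof. by move=> Ds; rewrite /ext indicE memNset// mul0r. Qed.

Let integral_ext_time (f : R -> \bar R) (g : R -> \bar R) :
  (forall s, D s -> f s = g s) -> (forall s, ~ D s -> f s = 0%E) ->
  (\int[leb]_s f s = \int[leb]_(s in D) g s)%E.
Proof.
move=> fg f0; rewrite [RHS]integral_mkcond; apply: eq_integral => s _.
rewrite patchE; case: ifPn => [/set_mem/fg//|].
by rewrite notin_setE => /f0.
Qed.

Let int_H2 s : D s -> (\int[P]_w (H s w ^+ 2)%:E <= M%:E)%E.
Proof.
rewrite /D/= in_itv/= => /andP[s0 st].
have [_ iH2] := LH s0 st.
rewrite -(fineK (integrable_fin_num measurableT iH2)) lee_fin.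
exact: HM.
Qed.

Section exchange.
Variable X : T -> R.
Hypothesis LX : square_integrable P X.

Let f (z : measurableTypeR R * T) : \bar R := (X z.2 * ext z.1 z.2)%:E.

Let mf : measurable_fun setT f.
Proof.
apply/measurable_EFinP; apply: measurable_funM => //.
by apply: measurableT_comp => //; case: LX.
Qed.

(** |X H_s| is at most X^2 + H_s^2, whose expectation is bounded on [0, tau] uniformly in s by means
    of M; the time interval has finite length. *)
Let intf : (leb \x P)%E.-integrable setT f.
Proof.
have [mX iX2] := LX.
apply/integrable12ltyP => //.
pose B := (\int[P]_w (X w ^+ 2)%:E + M%:E)%E.
have Bfin : B \is a fin_num.
  by rewrite fin_numD (integrable_fin_num measurableT iX2).
apply: (@le_lt_trans _ _ (\int[leb]_(s in D) B)%E); last first.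
  rewrite integral_cst//= lte_mul_pinfty//.
  - rewrite /B adde_ge0//; first by apply: integral_ge0 => w _; rewrite lee_fin sqr_ge0.
    have D0 : D 0 by rewrite /D/= in_itv/= lexx.
    apply: le_trans (int_H2 D0).
    by apply: integral_ge0 => w _; rewrite lee_fin sqr_ge0.
  - by rewrite lebesgue_measure_itv/=; case: ifPn => // _; rewrite -EFinB ltry.
rewrite [leRHS]integral_mkcond; apply: ge0_le_integral => //.
- by move=> s _; exact: integral_ge0.
- have maf : measurable_fun setT (abse \o f) by exact: measurableT_comp.
  have af0 z : (0 <= (abse \o f) z)%E by exact: abse_ge0.
  exact: (measurable_fun_fubini_tonelli_F _ maf af0).
- apply/(measurable_restrictT _ _).1 => //; exact: measurable_cst.
move=> s _; rewrite patchE; case: ifPn => [/set_mem Ds|]; last first.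
  rewrite notin_setE => nDs; rewrite integral0_eq// => w _.
  by rewrite /f/= ext0// mulr0 normr0.
have [s0 st] : 0 <= s /\ s <= tau by move: Ds; rewrite /D/= in_itv/= => /andP.
have [mHs iHs2] := LH s0 st.
apply: (@le_trans _ _ (\int[P]_w ((X w ^+ 2)%:E + (H s w ^+ 2)%:E))%E).
  apply: ge0_le_integral => //.
  - apply/measurable_EFinP; apply: measurableT_comp => //.
    apply: measurable_funM => //.
    under eq_fun do rewrite /= extE//; exact: mHs.
  - by apply/measurable_EFinP; apply: measurable_funD; exact: measurable_funX.
  move=> w _; rewrite /f/= extE// lee_fin.
  rewrite ler_norml; have := sqr_ge0 (X w + H s w); have := sqr_ge0 (X w - H s w).
  rewrite sqrrB sqrrD; have := sqr_ge0 (X w); have := sqr_ge0 (H s w).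
  by move: (X w ^+ 2) (H s w ^+ 2) (X w * H s w) => a b c *; apply/andP; split; lra.
rewrite integralD//= leeD2l//; exact: int_H2.
Qed.

Let fubini_time w : (\int[leb]_s f (s, w) = (X w * time_integral w)%:E)%E.
Proof.
rewrite (integral_ext_time (g := fun s => (X w)%:E * (H s w)%:E)%E).
- transitivity ((X w)%:E * (time_integral w)%:E)%E => //.
  rewrite integralZl//; last exact: iHD.
  congr (_ * _)%E.
  by rewrite /time_integral/Rintegral fineK//; exact: (integrable_fin_num mD (iHD w)).
- by move=> s Ds; rewrite /f/= extE.
- by move=> s Ds; rewrite /f/= ext0// mulr0.
Qed.

(** The common source of the mean (X = 1), of the covariance with an independent part, and of the
    second moment (X the time integral itself). *)
Lemma Rintegral_time_integralM : \int[P]_w (X w * time_integral w) =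
  \int[leb]_(s in D) \int[P]_w (X w * H s w).
Proof.
rewrite {1}/Rintegral.
under eq_integral do rewrite -fubini_time.
rewrite -(Fubini intf) /Rintegral; congr fine.
apply: integral_ext_time => [s Ds|s Ds]; last first.
  by rewrite integral0_eq// => w _; rewrite /f/= ext0// mulr0.
have [s0 st] : 0 <= s /\ s <= tau by move: Ds; rewrite /D/= in_itv/= => /andP.
rewrite fineK; last first.
  by apply: integrable_fin_num => //; apply: square_integrableM => //; exact: LH.
by apply: eq_integral => w _; rewrite /f/= extE.
Qed.

End exchange.

Lemma measurable_time_integral : measurable_fun setT time_integral.
Proof.
pose g (z : measurableTypeR R * T) : \bar R := (ext z.1 z.2)%:E.
have mg : measurable_fun setT g by exact/measurable_EFinP.
have -> : time_integral = fine \o (fun w => \int[leb]_s g (s, w))%E.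
  apply/funext => w; rewrite /time_integral /Rintegral/=; congr fine.
  apply/esym; apply: integral_ext_time => s Ds; rewrite /g/=; first by rewrite extE.
  by rewrite ext0.
apply: measurableT_comp => //.
have -> : (fun w => \int[leb]_s g (s, w))%E =
    (fubini_G leb g^\+ \- fubini_G leb g^\-)%E.
  apply/funext => w; rewrite [LHS]integralE /fubini_G/=.
  by congr (_ - _)%E; apply: eq_integral => s _; rewrite ?funeposE ?funenegE.
apply: emeasurable_funB; apply: measurable_fun_fubini_tonelli_G => //.
- exact: measurable_funepos.
- exact: measurable_funeneg.
Qed.

(** Cauchy-Schwarz, read off from \int (H - c)^2 >= 0 with c the time average. It makes the time
    integral square integrable, so that it may itself play the role of X above. *)
Lemma time_integral_sqr_le w :
  time_integral w ^+ 2 <= tau * \int[leb]_(s in D) (H s w ^+ 2).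
Proof.
have [t0|t0] := eqVneq tau 0.
  rewrite t0 mul0r /time_integral /D t0 set_itv1 Rintegral_set1.
  by rewrite expr0n.
have tau_gt0 : 0 < tau by rewrite lt_neqAle eq_sym t0.
pose c := time_integral w / tau.
have icst (k : R) : leb.-integrable D (EFin \o cst k).
  by apply: continuous_compact_integrable; [exact: segment_compact|move=> ?; exact: cvg_cst].
have i1 : leb.-integrable D (EFin \o (fun s => - 2 * c * H s w)).
  by have := integrableZl mD (- 2 * c) (iHD w).
have i2 : leb.-integrable D (EFin \o (fun s => H s w ^+ 2 + - 2 * c * H s w)).
  by have := integrableD mD (iH2D w) i1.
have : 0 <= \int[leb]_(s in D) ((H s w - c) ^+ 2).
  by apply: Rintegral_ge0 => s _; exact: sqr_ge0.
have -> : \int[leb]_(s in D) ((H s w - c) ^+ 2) =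
    \int[leb]_(s in D) ((H s w ^+ 2 + - 2 * c * H s w) + cst (c ^+ 2) s).
  by apply: eq_Rintegral => s _; rewrite /=; ring.
rewrite RintegralD// RintegralD//; last exact: iH2D.
rewrite RintegralZl// Rintegral_cst// -/(time_integral w).
rewrite [X in c ^+ 2 * X](_ : _ = tau); last first.
  have hD : lebesgue_measure (`[0, tau]%classic : set R) = tau%:E.
    by rewrite lebesgue_measure_itv/= lte_fin tau_gt0 -EFinB subr0.
  exact: (congr1 fine hD).
have -> : time_integral w = c * tau by rewrite /c divfK.
move: (Rintegral _ _ _) => J; rewrite -subr_ge0 => h.
by have := mulr_ge0 tau0 h; congr (0 <= _); ring.
Qed.

Lemma square_integrable_time_integral : square_integrable P time_integral.
Proof.
split; first exact: measurable_time_integral.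
have mT := measurable_time_integral.
apply/integrableP; split; first by apply/measurable_EFinP; exact: measurable_funX.
pose g (z : measurableTypeR R * T) : \bar R := (ext z.1 z.2 ^+ 2)%:E.
have mg : measurable_fun setT g by apply/measurable_EFinP; exact: measurable_funX.
have g0 z : (0 <= g z)%E by rewrite lee_fin sqr_ge0.
have gE w : (\int[leb]_s g (s, w) = (\int[leb]_(s in D) (H s w ^+ 2))%:E)%E.
  rewrite (integral_ext_time (g := fun s => (H s w ^+ 2)%:E)).
  - by rewrite /Rintegral fineK//; exact: integrable_fin_num.
  - by move=> s Ds; rewrite /g/= extE.
  - by move=> s Ds; rewrite /g/= ext0// expr0n.
apply: (@le_lt_trans _ _ (\int[P]_w (tau%:E * \int[leb]_s g (s, w)))%E).
  apply: ge0_le_integral => //.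
  - apply: measurableT_comp => //.
    by apply/measurable_EFinP; exact: measurable_funX.
  - apply: emeasurable_funM => //.
    exact: (measurable_fun_fubini_tonelli_G _ mg g0).
  move=> w _; rewrite gE -EFinM gee0_abs ?lee_fin ?sqr_ge0//.
  exact: time_integral_sqr_le.
rewrite ge0_integralZl//; last 2 first.
- exact: (measurable_fun_fubini_tonelli_G _ mg g0).
- by move=> w _; exact: integral_ge0.
rewrite lte_mul_pinfty//.
rewrite -(fubini_tonelli _ mg g0).
apply: (@le_lt_trans _ _ (\int[leb]_(s in D) M%:E)%E); last first.
  rewrite integral_cst//= lebesgue_measure_itv/=.
  by case: ifPn => _; rewrite ?mule0 ?ltry// -EFinD -EFinM ltry.
rewrite (integral_ext_time (g := fun s => \int[P]_w (H s w ^+ 2)%:E)%E).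
- apply: ge0_le_integral => //.
  + by move=> s _; apply: integral_ge0 => w _; rewrite lee_fin sqr_ge0.
  + have := @measurable_fun_fubini_tonelli_F _ _ _ _ _ P _ mg g0.
    move=> /(@measurable_funTS _ _ _ _ D).
    apply: eq_measurable_fun => s /set_mem Ds.
    by apply: eq_integral => w _; rewrite /g/= extE.
- by move=> s Ds; apply: eq_integral => w _; rewrite /g/= extE.
- by move=> s Ds; rewrite integral0_eq// => w _; rewrite /g/= ext0// expr0n.
Qed.

(** Two exchanges of integrals: first against the time integral itself, then against [H s]. *)
Lemma second_moment_time_integral : \int[P]_w (time_integral w ^+ 2) =
  \int[leb]_(s in D) \int[leb]_(u in D) \int[P]_w (H s w * H u w).
Proof.
rewrite (_ : (\int[P]_w (time_integral w ^+ 2)) =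
  \int[P]_w (time_integral w * time_integral w))//.
rewrite (Rintegral_time_integralM square_integrable_time_integral).
apply: eq_Rintegral => s /set_mem Ds.
have [s0 st] : 0 <= s /\ s <= tau by move: Ds; rewrite /D/= in_itv/= => /andP.
rewrite -(Rintegral_time_integralM (LH s0 st)).
by apply: eq_Rintegral => w _; rewrite mulrC.
Qed.

Lemma mean_time_integral :
  \int[P]_w time_integral w = \int[leb]_(s in D) \int[P]_w H s w.
Proof.
have := Rintegral_time_integralM (square_integrable_cst P 1).
under eq_Rintegral do rewrite mul1r.
by move=> ->; apply: eq_Rintegral => s _; apply: eq_Rintegral => w _; rewrite mul1r.
Qed.

End time_integral.

(** * The matrix exponential of the drift and the invariant covariance *)

Section covariance_matrix.
Context {R : realType}.
Implicit Types (K N m n k : nat) (t : R).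

(** Binomial formula for - 1 plus the nilpotent shift. The exponent k + (j - i) has the parity of k
    - (j - i) and avoids a truncated subtraction. *)
Lemma ou_drift_exp K k (i j : 'I_K) : ((ou_drift K : 'M[R]_K) ^+ k) i j =
  if (i <= j)%N then 'C(k, j - i)%:R * (-1) ^+ (k + (j - i)) else 0.
Proof.
elim: k i j => [|k IH] i j.
  rewrite expr0 mxE -val_eqE/=; case: (ltngtP i j) => [ij|ij|->].
  - by rewrite mulr0n bin0n subn_eq0 leqNgt ij/= mul0r.
  - by rewrite mulr0n.
  - by rewrite subnn bin0 mul1r.
rewrite exprS mxE.
under eq_bigr => l _.
  rewrite [ou_drift K i l]mxE (_ : (if _ then _ else _) =
    - (l == i)%:R + (l == i.+1 :> nat)%:R); last first.
    rewrite eq_sym; have [->|_] := eqVneq l i.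
      by rewrite ltn_eqF ?addr0.
    by rewrite oppr0 add0r; case: ifP.
  rewrite mulrDl mulNr; over.
rewrite big_split/= sumrN (bigD1 i)//= eqxx mul1r big1 ?addr0; last first.
  by move=> l /negbTE ->; rewrite mul0r.
rewrite IH; have [iK|iK] := ltnP i.+1 K.
  pose i1 := Ordinal iK.
  rewrite (bigD1 i1)//= eqxx mul1r big1 ?addr0; last first.
    by move=> l; rewrite -val_eqE/= => /negbTE ->; rewrite mul0r.
  rewrite IH/=; case: (ltngtP i j) => [ij|ij|/val_inj ij].
  - rewrite -(subnSK ij) binS natrD mulrDl; congr (_ + _).
      by rewrite addSn exprS mulN1r mulrN.
    by rewrite addSn addnS !exprS !mulN1r opprK.
  - by rewrite oppr0 addr0.
  - by rewrite ij subnn !bin0 !mul1r addr0 !addn0 exprS mulN1r.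
rewrite big1 ?addr0; last first.
  by move=> l _; rewrite ltn_eqF ?mul0r// (leq_trans (ltn_ord l)).
have : (j <= i)%N by rewrite -ltnS (leq_trans (ltn_ord j)).
case: (ltngtP i j) => // [_ _|/val_inj -> _]; first by rewrite oppr0.
by rewrite subnn !bin0 !mul1r !addn0 exprS mulN1r.
Qed.

(** With m = j - i, the terms of index below m vanish, and the series shifted by m is t^m / m! times
    the exponential series of - t. *)
Lemma expmx_ou_drift N t (i j : 'I_N.+1) : (i <= j)%N ->
  expmx (t *: ou_drift N.+1) i j = psi (j - i) t.
Proof.
move=> ij; rewrite mxE; have aE k := ou_drift_exp k i j.
move: (j - i)%N aE => m; rewrite ij => aE.
set u := (u in series u).
have uE k : u k = k`!%:R^-1 * (t ^+ k * ('C(k, m)%:R * (-1) ^+ (k + m))).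
  by rewrite /u mxE exprZn mxE aE.
have u0 k : (k < m)%N -> u k = 0.
  by move=> km; rewrite uE bin_small// mul0r !mulr0.
have um l : u (l + m)%N = (m`!%:R^-1 * t ^+ m) * exp_coeff (- t) l.
  rewrite uE /exp_coeff/= [(- t) ^+ l]exprNn [t ^+ (l + m)]exprD.
  have fE : (l + m)`!%:R^-1 * 'C(l + m, m)%:R = m`!%:R^-1 * l`!%:R^-1 :> R.
    have := bin_fact (leq_addl l m); rewrite addnK => /(congr1 (fun x : nat => x%:R : R)).
    rewrite !natrM => <-.
    have [a0 b0 c0] : [/\ m`!%:R != 0 :> R, l`!%:R != 0 :> R & 'C(l + m, m)%:R != 0 :> R].
      by split; rewrite pnatr_eq0 -lt0n ?fact_gt0// bin_gt0 leq_addl.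
    by move: (m`!%:R : R) (l`!%:R : R) ('C(_, _)%:R : R) a0 b0 c0 => a b c a0 b0 c0; field;
      rewrite a0 b0 c0.
  have -> : (-1) ^+ (l + m + m) = (-1) ^+ l :> R.
    by rewrite -addnA exprD addnn -mul2n exprM sqrrN expr1n expr1n mulr1.
  transitivity ((l + m)`!%:R^-1 * 'C(l + m, m)%:R * (t ^+ l * t ^+ m * (-1) ^+ l)).
    by move: ((l + m)`!%:R^-1) ('C(_, _)%:R) => a b; ring.
  by rewrite fE; ring.
have sum_m n : series u (n + m)%N = (m`!%:R^-1 * t ^+ m) * series (exp_coeff (- t)) n.
  rewrite /series/= addnC (big_cat_nat (n := m)) ?leq_addr//=.
  rewrite big_nat big1 ?add0r; last by move=> k /andP[_]; exact: u0.
  rewrite -{1}[m]add0n big_addn addKn mulr_sumr.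
  by apply: eq_bigr => l _; rewrite um.
have : series u n @[n --> \oo] --> (m`!%:R^-1 * t ^+ m) * expR (- t).
  rewrite -(cvg_shiftn m); under eq_fun do rewrite sum_m.
  apply: cvgM; first exact: cvg_cst.
  exact: is_cvg_series_exp_coeff.
by move/cvg_lim => ->//; rewrite /psi mulrA.
Qed.

Lemma expmx_tr K (M : 'M[R]_K) : expmx M^T = (expmx M)^T.
Proof.
apply/matrixP => i j; rewrite !mxE; congr (limn (series _)).
apply/funext => k; rewrite !mxE; congr (_ * _).
suff -> : M^T ^+ k = (M ^+ k)^T by rewrite mxE.
elim: k => [|k IH]; first by rewrite !expr0 trmx1.
by rewrite exprS IH exprSr; exact/esym/trmx_mul.
Qed.

(** Closed form of \int_0^oo psi_m psi_n. The product is a multiple of psi_(m+n)(2 t): the powers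
    give 2^-(m+n), and the substitution 2 t one more factor 1/2. *)
Definition ou_cov m n : R := 'C(m + n, n)%:R / 2 ^+ (m + n).+1.

Lemma ou_cov_gt0 m n : 0 < ou_cov m n.
Proof. by rewrite divr_gt0 ?exprn_gt0// ltr0n bin_gt0 leq_addl. Qed.

Lemma ou_covC m n : ou_cov m n = ou_cov n m.
Proof.
rewrite /ou_cov [in RHS]addnC; congr (_%:R / _).
by rewrite -bin_sub ?leq_addl// addnK.
Qed.

(* Entrywise form of the Lyapunov equation A S + S A^T = - e_K e_K^T. *)
Lemma ou_cov_lyapunov m n :
  (if m is m'.+1 then ou_cov m' n else 0) + (if n is n'.+1 then ou_cov n' m else 0) =
  2 * ou_cov m n - ((m == 0%N) && (n == 0%N))%:R.
Proof.
have half k (c : R) : 2 * (c / 2 ^+ k.+1) = c / 2 ^+ k.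
  by rewrite exprS invfM mulrCA !mulrA mulfK// mulrC.
case: m n => [|m] [|n]; rewrite /ou_cov half.
- by rewrite !addn0 bin0 expr0 divr1 addr0 subrr.
- by rewrite add0r subr0 addn0 add0n bin0 binn.
- by rewrite addr0 subr0 !addn0 !bin0.
- rewrite subr0 (_ : (n + m.+1 = m + n.+1)%N); last by rewrite addnC addSnnS.
  rewrite addSn -mulrDl binS natrD; congr ((_ + _%:R) / _).
  have {1}-> : m.+1 = (m + n.+1 - n)%N by rewrite addnS subSn ?leq_addl// addnK.
  by rewrite bin_sub// addnS ltnW// ltnS leq_addl.
Qed.

Lemma Rintegral_psiM m n :
  \int[lebesgue_measure]_(t in `[0, +oo[) (psi m t * psi n t) = ou_cov m n.
Proof.
pose c : R := 'C(m + n, n)%:R / 2 ^+ (m + n).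
have psiE t : psi m t * psi n t = c * psi (m + n) (2 * t).
  rewrite /psi exprMn.
  have -> : expR (- (2 * t)) = expR (- t) * expR (- t).
    by rewrite -expRD; congr expR; ring.
  have := bin_fact (leq_addl m n); rewrite addnK => /(congr1 (fun x : nat => x%:R : R)).
  rewrite !natrM [t ^+ (m + n)]exprD /c => <-.
  have [a0 b0 c0] : [/\ m`!%:R != 0 :> R, n`!%:R != 0 :> R & 'C(m + n, n)%:R != 0 :> R].
    by split; rewrite pnatr_eq0 -lt0n ?fact_gt0// bin_gt0 leq_addl.
  have d0 : 2 ^+ (m + n) != 0 :> R by rewrite expf_neq0.
  move: (m`!%:R : R) (n`!%:R : R) ('C(_, _)%:R : R) (2 ^+ (m + n) : R) a0 b0 c0 d0 => a b c' d a0 b0 c0 d0.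
  by field; rewrite a0 b0 c0 d0.
pose Q t := c / 2 * gammaP (m + n) (2 * t).
have dQ (t : R) : is_derive t (1 : R) Q (psi m t * psi n t).
  refine (is_derive_eq (is_deriveZ_fun (c / 2) (is_derive_comp_fun
    (is_derive_gammaP (m + n) (2 * t)) (is_deriveZ_fun 2 (is_derive_id t (1 : R))))) _).
  by rewrite psiE mulr1 [psi _ _ * 2]mulrC mulrA divfK.
rewrite (@Rintegral_ge0_continuous_FTC2y R _ Q 0 (c / 2)).
- by rewrite /Q mulr0 gammaP_at0 mulr0 subr0 /c /ou_cov exprS invfM mulrCA mulrC.
- by move=> t t0; rewrite mulr_ge0// psi_ge0.
- apply: continuous_subspaceT => t.
  by apply: cvgM; exact: continuous_psi.
- rewrite /Q -[X in _ --> X]mulr1; apply: cvgM; first exact: cvg_cst.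
  apply: (@cvg_comp _ _ _ (fun t => 2 * t) (gammaP (m + n)) _ +oo%R); last exact: cvg_gammaP.
  by apply: gt0_cvgMry => //; exact: cvg_id.
- by move=> t _; case: (dQ t).
- by apply/cvg_at_right_filter; exact: is_derive_continuous (dQ 0).
- by move=> t _; exact: is_derive_derive1.
Qed.

(** e^(tA) e_K is the last column of the exponential, with entries psi (N - k), so the indices count
    from the last coordinate. *)
Lemma ou_invariant_covE N (i j : 'I_N.+1) :
  ou_invariant_cov N.+1 i j = ou_cov (N - i) (N - j) :> R.
Proof.
rewrite mxE -Rintegral_psiM; apply: eq_Rintegral => t _.
have vE (k : 'I_N.+1) : (expmx (t *: ou_drift N.+1) *m ou_noise N.+1) k 0 = psi (N - k) t :> R.
  rewrite mxE (bigD1 ord_max)//= big1 ?addr0; last first.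
    move=> l lN; rewrite [ou_noise _ _ _]mxE eqSS ifN ?mulr0//.
  by rewrite [ou_noise _ _ _]mxE eqxx mulr1 expmx_ou_drift//= -ltnS.
rewrite -linearZ/= expmx_tr -mulmxA -trmx_mul mxE big_ord1 -[RHS]/(_ * _).
by rewrite vE [X in _ * X]mxE vE.
Qed.

End covariance_matrix.

(** * The explicit variance and its two components *)

Section integrated_covariance.
Context {R : realType}.
Variable N : nat.
Implicit Types (t x y tau : R).

(** The primitive of P_m vanishing at 0, by parts: t psi_m = (m + 1) psi_(m+1). *)
Definition gammaP_primitive m t : R := t * gammaP m t - m.+1%:R * gammaP m.+1 t.

Lemma is_derive_gammaP_primitive m t :
  is_derive t 1 (gammaP_primitive m) (gammaP m t).
Proof.
refine (is_derive_eq (is_deriveB_fun (is_deriveM_fun (is_derive_id t (1 : R))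
  (is_derive_gammaP m t)) (is_deriveZ_fun m.+1%:R (is_derive_gammaP m.+1 t))) _).
have -> : m.+1%:R * psi m.+1 t = t * psi m t.
  rewrite /psi factS natrM invfM exprS -!mulrA mulVKf ?pnatr_eq0//.
  by rewrite mulrCA.
by rewrite mul1r addrK.
Qed.

Lemma gammaP_primitive_at0 m : gammaP_primitive m 0 = 0 :> R.
Proof. by rewrite /gammaP_primitive mul0r gammaP_at0 mulr0 subrr. Qed.

(* Half the derivative of the integrated variance: the integral over [0, t] of
   the autocovariance of the first coordinate. *)
Definition autocov_primitive t : R :=
  \sum_(j < N.+1) ou_cov N (N - j) * gammaP j t.

(** The closed form that V will be shown to have on [0, +oo[. The weight of index j is the invariant
    covariance of the coordinates of index 0 and j. *)
Definition ou_variance t : R :=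
  2 * \sum_(j < N.+1) ou_cov N (N - j) * gammaP_primitive j t.

Lemma ou_variance_at0 : ou_variance 0 = 0.
Proof.
by rewrite /ou_variance big1 ?mulr0// => j _; rewrite gammaP_primitive_at0 mulr0.
Qed.

Lemma is_derive_ou_variance t :
  is_derive t 1 ou_variance (2 * autocov_primitive t).
Proof.
refine (is_deriveZ_fun 2 (is_derive_sum_fun (fun j : 'I_N.+1 =>
  is_deriveZ_fun (ou_cov N (N - j)) (is_derive_gammaP_primitive j t)))).
Qed.

Lemma continuous_autocov_primitive : continuous autocov_primitive.
Proof.
move=> t; apply: is_derive_continuous.
exact: (is_derive_sum_fun (fun j : 'I_N.+1 =>
  is_deriveZ_fun (ou_cov N (N - j)) (is_derive_gammaP j t))).
Qed.

Lemma autocov_primitive_ge0 t : 0 <= t -> 0 <= autocov_primitive t.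
Proof.
move=> t0; apply: sumr_ge0 => j _.
by rewrite mulr_ge0 ?gammaP_ge0// ltW// ou_cov_gt0.
Qed.

Lemma autocov_primitive_gt0 t : 0 < t -> 0 < autocov_primitive t.
Proof.
move=> t0; rewrite /autocov_primitive big_ord_recl ltr_wpDr//.
  by apply: sumr_ge0 => j _; rewrite mulr_ge0 ?gammaP_ge0// ltW// ou_cov_gt0.
by rewrite mulr_gt0 ?gammaP_gt0// ou_cov_gt0.
Qed.

Lemma autocov_primitive_le x y : 0 <= x -> x <= y ->
  autocov_primitive x <= autocov_primitive y.
Proof.
move=> x0 xy; apply: ler_sum => j _.
by rewrite ler_wpM2l ?gammaP_le// ltW// ou_cov_gt0.
Qed.

(** One factor P_N is compared with [autocov_primitive] term by term, through the ratios P_j / P_N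
    with j <= N; the other factor is nondecreasing by itself. *)
Lemma gammaP_autocov_ratio x y : 0 <= x -> x <= y ->
  gammaP N x ^+ 2 * autocov_primitive y <= gammaP N y ^+ 2 * autocov_primitive x.
Proof.
move=> x0 xy; have y0 := le_trans x0 xy.
have h : autocov_primitive y * gammaP N x <= autocov_primitive x * gammaP N y.
  rewrite !mulr_suml; apply: ler_sum => j _.
  rewrite -[_ * _ * gammaP N x]mulrA -[_ * _ * gammaP N y]mulrA.
  by rewrite ler_wpM2l ?(ltW (ou_cov_gt0 _ _))// gammaP_ratio// -ltnS.
apply: (@le_trans _ _ (gammaP N x * (autocov_primitive x * gammaP N y))).
  by rewrite expr2 -mulrA ler_wpM2l ?gammaP_ge0// mulrC.
rewrite [leLHS](_ : _ = (autocov_primitive x * gammaP N y) * gammaP N x); last by ring.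
rewrite [leRHS](_ : _ = (autocov_primitive x * gammaP N y) * gammaP N y); last by ring.
by rewrite ler_wpM2l ?gammaP_le// mulr_ge0 ?gammaP_ge0// autocov_primitive_ge0.
Qed.

(** The quadratic form p^T S p, that is, the variance of \sum_i P_i(t) Y_0^i. *)
Definition initial_variance t : R :=
  \sum_(i < N.+1) \sum_(j < N.+1) ou_cov (N - i) (N - j) * (gammaP i t * gammaP j t).

Lemma initial_variance_at0 : initial_variance 0 = 0.
Proof.
rewrite /initial_variance big1// => i _; rewrite big1// => j _.
by rewrite gammaP_at0 mul0r mulr0.
Qed.

(** The entries of (A + 1) S: row i of S replaced by row i + 1, and the last row by 0. *)
Let shift_cov (i j : 'I_N.+1) : R :=
  if (N - i)%N is m.+1 then ou_cov m (N - j) else 0.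

Lemma psi_gammaP (i : nat) t :
  psi i t = (if i is i'.+1 then gammaP i' t else 1) - gammaP i t.
Proof. by case: i => [|i]; rewrite ?gammaP0 ?gammaPS opprB subrKC. Qed.

(** Since p' = e_1 + A^T p, the derivative of p^T S p is 2 e_1^T S p + p^T (A S + S A^T) p; the
    Lyapunov equation turns the last term into - P_N^2. *)
Lemma is_derive_initial_variance t : is_derive t 1 initial_variance
  (2 * autocov_primitive t - gammaP N t ^+ 2).
Proof.
refine (is_derive_eq (is_derive_sum_fun (fun i : 'I_N.+1 => is_derive_sum_fun
  (fun j : 'I_N.+1 => is_deriveZ_fun (ou_cov (N - i) (N - j))
  (is_deriveM_fun (is_derive_gammaP i t) (is_derive_gammaP j t))))) _).
pose r (i : nat) : R := \sum_(j < N.+1) ou_cov (N - i) (N - j) * gammaP j t.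
transitivity (2 * \sum_(i < N.+1) psi i t * r i).
  have symE : \sum_(i < N.+1) \sum_(j < N.+1)
      ou_cov (N - i) (N - j) * (gammaP i t * psi j t) = \sum_(i < N.+1) psi i t * r i.
    rewrite exchange_big/=; apply: eq_bigr => i _; rewrite mulr_sumr.
    by apply: eq_bigr => j _; rewrite ou_covC; ring.
  transitivity (\sum_(i < N.+1) psi i t * r i + \sum_(i < N.+1) psi i t * r i); last by ring.
  rewrite -[X in _ = _ + X]symE -big_split/=; apply: eq_bigr => i _.
  rewrite mulr_sumr -big_split/=; apply: eq_bigr => j _.
  by rewrite mulrDr mulrCA.
have r0E : r 0%N = autocov_primitive t by apply: eq_bigr => j _; rewrite subn0.
(* Summation by parts with psi_i = P_(i-1) - P_i and P_(-1) = 1: the boundary term is [r 0], and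
   reindexing moves the shift onto S. *)
have abel : \sum_(i < N.+1) psi i t * r i =
    r 0%N + \sum_(i < N.+1) \sum_(j < N.+1) shift_cov i j * (gammaP i t * gammaP j t)
    - initial_variance t.
  under eq_bigr do rewrite psi_gammaP mulrBl.
  rewrite sumrB; congr (_ - _); last first.
    by apply: eq_bigr => i _; rewrite mulr_sumr; apply: eq_bigr => j _; rewrite mulrCA.
  rewrite big_ord_recl mul1r; congr (_ + _).
  rewrite [RHS]big_ord_recr/= [X in _ = _ + X]big1 ?addr0; last first.
    by move=> j _; rewrite /shift_cov/= subnn mul0r.
  apply: eq_bigr => i _; rewrite mulr_sumr; apply: eq_bigr => j _.
  by rewrite /shift_cov/= -(subnSK (ltn_ord i)) mulrCA.
(* Averaging with the transposed sum produces A S + S A^T, of which only the last diagonal entry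
   survives. *)
have lyap : 2 * \sum_(i < N.+1) \sum_(j < N.+1) shift_cov i j * (gammaP i t * gammaP j t) =
    2 * initial_variance t - gammaP N t ^+ 2.
  set A := \sum_(i < N.+1) _.
  have AE : A = \sum_(i < N.+1) \sum_(j < N.+1) shift_cov j i * (gammaP i t * gammaP j t).
    rewrite /A exchange_big/=; apply: eq_bigr => i _; apply: eq_bigr => j _.
    by rewrite [gammaP j t * _]mulrC.
  have -> : 2 * A = A + A by ring.
  rewrite [X in _ + X]AE /A -big_split/= /initial_variance mulr_sumr.
  have -> : gammaP N t ^+ 2 = \sum_(i < N.+1) \sum_(j < N.+1)
      (((N - i == 0) && (N - j == 0))%N)%:R * (gammaP i t * gammaP j t).
    rewrite (bigD1 ord_max)//= [X in _ = _ + X]big1 ?addr0; last first.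
      move=> i iN; rewrite big1// => j _.
      rewrite subn_eq0 leqNgt (_ : (i < N)%N) ?mul0r//.
      by rewrite ltn_neqAle -ltnS ltn_ord andbT; apply: contra iN => /eqP iN; apply/eqP/val_inj.
    rewrite (bigD1 ord_max)//= [X in _ = _ + X]big1 ?addr0; last first.
      move=> i iN; rewrite andbC subn_eq0 leqNgt (_ : (i < N)%N) ?mul0r//.
      by rewrite ltn_neqAle -ltnS ltn_ord andbT; apply: contra iN => /eqP iN; apply/eqP/val_inj.
    by rewrite subnn eqxx mul1r.
  rewrite -sumrB; apply: eq_bigr => i _.
  rewrite mulr_sumr -big_split/= -sumrB; apply: eq_bigr => j _.
  have L : shift_cov i j + shift_cov j i = _ := ou_cov_lyapunov (N - i) (N - j).
  by rewrite -mulrDl L mulrBl mulrA.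
rewrite abel r0E mulrBr mulrDr lyap; ring.
Qed.

(** Equal to \int_0^t P_N^2, the variance expected of the noise part: it vanishes at 0 and has
    derivative P_N^2. *)
Let remainder t := ou_variance t - initial_variance t.

Let is_derive_remainder t : is_derive t 1 remainder (gammaP N t ^+ 2).
Proof.
refine (is_derive_eq (is_deriveB_fun (is_derive_ou_variance t)
  (is_derive_initial_variance t)) _).
by ring.
Qed.

(** By parts this is \int_0^s P_N(tau - u) du, since [Num.min s u] has slope 1 before s and 0 after;
    hence the splitting at u = s. *)
Lemma integral_psi_min tau s : 0 <= s -> s <= tau ->
  \int[lebesgue_measure]_(u in `[0, tau]) (psi N (tau - u) * Num.min s u) =
  gammaP_primitive N tau - gammaP_primitive N (tau - s).
Proof.
move=> s0 st.
have cpsi : continuous (fun u : R => psi N (tau - u)).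
  move=> u; apply: (@cvg_comp _ _ _ (fun u => tau - u) (psi N)); last exact: continuous_psi.
  by apply: cvgB; [exact: cvg_cst|exact: cvg_id].
have cmin : continuous (fun u : R => Num.min s u).
  by move=> u; apply: continuous_min; [exact: cvg_cst|exact: cvg_id].
have cf : continuous (fun u : R => psi N (tau - u) * Num.min s u).
  by move=> u; apply: cvgM; [exact: cpsi|exact: cmin].
have split_s := @Rintegral_itvB R (fun u => psi N (tau - u) * Num.min s u) (BLeft 0) (BRight tau) s.
have h1 : \int[lebesgue_measure]_(u in `[0, s]) (psi N (tau - u) * Num.min s u) =
    gammaP_primitive N tau - gammaP_primitive N (tau - s) - s * gammaP N (tau - s).
  pose q (u : R) := - (u * gammaP N (tau - u)) - gammaP_primitive N (tau - u).
  have dq (u : R) : is_derive u (1 : R) q (psi N (tau - u) * u).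
    refine (is_derive_eq (is_deriveB_fun (is_deriveN_fun (is_deriveM_fun
      (is_derive_id u (1 : R)) (is_derive_reflect (c := tau) (is_derive_gammaP N (tau - u)))))
      (is_derive_reflect (c := tau) (is_derive_gammaP_primitive N (tau - u)))) _).
    by ring.
  transitivity (\int[lebesgue_measure]_(u in `[0, s]) (psi N (tau - u) * u)).
    apply: eq_Rintegral => u; rewrite inE/= in_itv/= => /andP[_ us].
    by rewrite min_r.
  rewrite (Rintegral_is_derive s0 _ dq); last first.
    by move=> u; apply: cvgM; [exact: cpsi|exact: cvg_id].
  by rewrite /q subr0; ring.
have h2 : \int[lebesgue_measure]_(u in `]s, tau]) (psi N (tau - u) * Num.min s u) =
    s * gammaP N (tau - s).
  rewrite Rintegral_itv_obnd_cbnd; last first.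
    apply: integrableS (integrable_continuous s tau cf) => //.
    exact: subset_itv_oc_cc.
  pose q (u : R) := - s * gammaP N (tau - u).
  have dq (u : R) : is_derive u (1 : R) q (psi N (tau - u) * s).
    refine (is_derive_eq (is_deriveZ_fun (- s)
      (is_derive_reflect (c := tau) (is_derive_gammaP N (tau - u)))) _).
    by ring.
  transitivity (\int[lebesgue_measure]_(u in `[s, tau]) (psi N (tau - u) * s)).
    apply: eq_Rintegral => u; rewrite inE/= in_itv/= => /andP[su _].
    by rewrite min_l.
  rewrite (Rintegral_is_derive st _ dq); last first.
    by move=> u; apply: cvgM; [exact: cpsi|exact: cvg_cst].
  by rewrite /q subrr gammaP_at0; ring.
have := split_s (integrable_continuous _ _ cf).
rewrite h1 h2 !bnd_simp => /(_ s0 st)/eqP; rewrite subr_eq => /eqP ->.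
by ring.
Qed.

(* The variance of the stochastic convolution \int_0^tau F(tau - s) dB_s. *)
Lemma integral_psi_psi_min tau : 0 <= tau ->
  \int[lebesgue_measure]_(s in `[0, tau]) \int[lebesgue_measure]_(u in `[0, tau])
    (psi N (tau - s) * psi N (tau - u) * Num.min s u) =
  ou_variance tau - initial_variance tau.
Proof.
move=> tau0.
have cpsi : continuous (fun u : R => psi N (tau - u)).
  move=> u; apply: (@cvg_comp _ _ _ (fun u => tau - u) (psi N)); last exact: continuous_psi.
  by apply: cvgB; [exact: cvg_cst|exact: cvg_id].
have cmin s : continuous (fun u : R => Num.min s u).
  by move=> u; apply: continuous_min; [exact: cvg_cst|exact: cvg_id].
pose h s := gammaP_primitive N tau - gammaP_primitive N (tau - s).
have dh (s : R) : is_derive s (1 : R) h (gammaP N (tau - s)).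
  refine (is_derive_eq (is_deriveB_fun (is_derive_cst (gammaP_primitive N tau) s (1 : R))
    (is_derive_reflect (c := tau) (is_derive_gammaP_primitive N (tau - s)))) _).
  by ring.
(* Integration by parts against h, whose derivative is P_N(tau - s), leaves the integral of P_N(tau
   - s)^2, whose primitive is [remainder] reflected. *)
pose q s := - (gammaP N (tau - s) * h s) - remainder (tau - s).
have dq (s : R) : is_derive s (1 : R) q (psi N (tau - s) * h s).
  refine (is_derive_eq (is_deriveB_fun (is_deriveN_fun (is_deriveM_fun
    (is_derive_reflect (c := tau) (is_derive_gammaP N (tau - s))) (dh s)))
    (is_derive_reflect (c := tau) (is_derive_remainder (tau - s)))) _).
  by ring.
transitivity (\int[lebesgue_measure]_(s in `[0, tau]) (psi N (tau - s) * h s)).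
  apply: eq_Rintegral => s; rewrite inE/= in_itv/= => /andP[s0 st].
  under eq_Rintegral do rewrite -mulrA.
  rewrite RintegralZl//; first by rewrite integral_psi_min.
  apply: integrable_continuous => u.
  by apply: cvgM; [exact: cpsi|exact: cmin].
rewrite (Rintegral_is_derive tau0 _ dq); last first.
  by move=> s; apply: cvgM; [exact: cpsi|exact: is_derive_continuous (dh s)].
rewrite /q /h subrr !subr0 gammaP_at0 subrr mulr0 mul0r oppr0 !sub0r.
rewrite /remainder ou_variance_at0 initial_variance_at0.
by rewrite opprK subrr oppr0 add0r.
Qed.

End integrated_covariance.

Section continuous_extension.
Context {R : realType}.

(** Freezing a path at its initial value for negative times makes it continuous everywhere, as the
    pathwise calculus below requires. *)
Lemma continuous_comp_max0 (f : R -> R) :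
  {within `[0, +oo[, continuous f} -> continuous (fun t : R => f (Num.max 0 t)).
Proof.
move=> /subspace_continuousP cf t.
have m0 : (`[0, +oo[%classic : set R) (Num.max 0 t).
  by rewrite /= in_itv/= andbT le_max lexx.
apply: cvg_comp (cf _ m0).
have h : Num.max 0 x @[x --> t] --> Num.max 0 t.
  by apply: continuous_max; [exact: cvg_cst|exact: cvg_id].
move=> U /= hU; have := h _ hU.
apply: (@filterS _ (nbhs t)) => x; apply.
by rewrite /= in_itv/= andbT le_max lexx.
Qed.

End continuous_extension.

(** * Pathwise integration by parts for the linear system *)

Section pathwise.
Context {R : realType}.
Notation leb := (@lebesgue_measure R).
Variables (N : nat) (Y : R -> 'I_N.+1 -> R) (W : R -> R).
Hypothesis cY : forall i, continuous (Y ^~ i).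
Hypothesis cW : continuous W.
Hypothesis YE : forall t i, 0 <= t -> Y t i = Y 0 i +
  \int[leb]_(s in `[0, t]) (\sum_(j < N.+1) ou_drift N.+1 i j * Y s j) +
  ou_noise N.+1 i 0 * W t.

Let drift (i : 'I_N.+1) t := \sum_(j < N.+1) ou_drift N.+1 i j * Y t j.

Let c_drift i : continuous (drift i).
Proof.
move=> t; apply: (cvg_big (op := +%R)); first exact: add_continuous.
by move=> j _; apply: cvgM; [exact: cvg_cst|exact: cY].
Qed.

(** [insub i.+1] is the next coordinate, or [None] at the last one, where the missing coordinate
    counts as 0. *)
Let driftE (i : 'I_N.+1) t :
  drift i t = (if insub i.+1 is Some j then Y t j else 0) - Y t i.
Proof.
rewrite /drift (bigD1 i)//= [ou_drift _ _ _]mxE eqxx mulN1r addrC; congr (_ - _).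
case: insubP => [k kN ki|iN].
  rewrite (bigD1 k)//=; last by rewrite -val_eqE/= ki gtn_eqF.
  rewrite [ou_drift _ _ _]mxE -val_eqE/= ki ltn_eqF// eqxx mul1r.
  rewrite big1 ?addr0// => l /andP[li lk]; rewrite mxE eq_sym (negbTE li).
  by rewrite ifN ?mul0r//; apply: contra lk; rewrite -val_eqE/= ki.
rewrite big1// => l li; rewrite mxE eq_sym (negbTE li) ifN ?mul0r//.
by apply: contra iN => /eqP <-.
Qed.

(** The part of Y without the noise: unlike Y it is differentiable for t > 0, with derivative the
    drift. *)
Let U (i : 'I_N.+1) t := Y 0 i + \int[leb]_(s in `[0, t]) drift i s.

Let is_derive_U i (t : R) : 0 < t -> is_derive t (1 : R) (U i) (drift i t).
Proof.
move=> t0; have t1 : t < t + 1 by rewrite ltrDl.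
have [dI IE] := @continuous_FTC1_closed R (drift i) 0 t (t + 1) t1
  (integrable_continuous _ _ (c_drift (i := i))) t0 (c_drift (x := t)).
have dI' : is_derive t (1 : R) (fun t => \int[leb]_(s in `[0, t]) drift i s) (drift i t).
  by apply: DeriveDef; [exact: dI|rewrite -derive1E].
refine (is_derive_eq (is_deriveD_fun (is_derive_cst (Y 0 i) t (1 : R)) dI') _).
by rewrite add0r.
Qed.

Let U0 i : U i 0 = Y 0 i.
Proof. by rewrite /U set_itv1 Rintegral_set1 addr0. Qed.

Let U_cvg0 i : U i x @[x --> 0^'+] --> U i 0.
Proof.
apply: cvg_at_right_filter; rewrite U0 -[X in _ --> X]addr0.
apply: cvgD; first exact: cvg_cst.
exact: (parameterized_integral_cvg_left ltr01 (integrable_continuous _ _ (c_drift (i := i)))).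
Qed.

(** [Phi] pairs U(t) with the weights P_i(tau - t). It vanishes at tau, equals the initial term at
    0, and its derivative is the noise term minus the first coordinate of Y. *)
Lemma ou_path_integral tau : 0 <= tau ->
  \int[leb]_(s in `[0, tau]) Y s ord0 =
  \sum_(i < N.+1) gammaP i tau * Y 0 i +
  \int[leb]_(s in `[0, tau]) (psi N (tau - s) * W s).
Proof.
rewrite le_eqVlt => /predU1P[<-|tau0].
  rewrite set_itv1 !Rintegral_set1 addr0 big1// => i _.
  by rewrite gammaP_at0 mul0r.
pose Phi t := \sum_(i < N.+1) gammaP i (tau - t) * U i t.
pose phi t := psi N (tau - t) * W t - Y t ord0.
have cpsiW : continuous (fun t => psi N (tau - t) * W t).
  move=> t; apply: cvgM; last exact: cW.
  apply: (@cvg_comp _ _ _ (fun u => tau - u) (psi N)); last exact: continuous_psi.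
  by apply: cvgB; [exact: cvg_cst|exact: cvg_id].
have cphi : continuous phi.
  by move=> t; apply: cvgB; [exact: cpsiW|exact: cY].
have dPhi (t : R) : 0 < t -> is_derive t (1 : R) Phi (phi t).
  move=> t0.
  refine (is_derive_eq (is_derive_sum_fun (fun i : 'I_N.+1 =>
    is_deriveM_fun (is_derive_reflect (c := tau) (is_derive_gammaP i (tau - t)))
      (is_derive_U i t0))) _).
  have UE i : U i t = Y t i - ou_noise N.+1 i 0 * W t.
    by rewrite (YE i (ltW t0)) addrK.
  rewrite /phi; set x := tau - t.
  transitivity (\sum_(i < N.+1) (psi i x * ou_noise N.+1 i 0 * W t +
     (gammaP i x * (if insub i.+1 is Some j then Y t j else 0) -
      (if i : nat is i'.+1 then gammaP i' x else 1) * Y t i))).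
    apply: eq_bigr => i _.
    have -> : (if i : nat is i'.+1 then gammaP i' x else 1) = psi i x + gammaP i x.
      by rewrite psi_gammaP subrK.
    by rewrite UE driftE; move: (if insub _ is Some j then _ else _) => z; ring.
  rewrite big_split/= sumrB; congr (_ + _).
    rewrite (bigD1 ord_max)//= big1 ?addr0 => [|i iN].
      by rewrite mxE eqxx mulr1.
    by rewrite mxE eqSS ifN ?mulr0 ?mul0r.
  (* Telescoping: P_i multiplies coordinate i + 1 in both sums, so only the first coordinate, with
     weight 1, remains. *)
  rewrite big_ord_recr/= insubF ?ltnn// mulr0 addr0.
  rewrite [X in _ - X]big_ord_recl mul1r opprD addrCA -[RHS]addr0; congr (_ + _).
  apply/eqP; rewrite subr_eq0; apply/eqP; apply: eq_bigr => i _ /=.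
  congr (_ * _); rewrite (insubT (fun n => n < N.+1)%N) ?ltnS//= => h.
  by congr (Y t _); apply/val_inj.
(* [U] is differentiable only at positive times, so 0 is reached by a right limit. *)
have cPhi0 : Phi x @[x --> 0^'+] --> Phi 0.
  apply: (cvg_big (op := +%R)); first exact: add_continuous.
  move=> i _; apply: cvgM; last exact: U_cvg0.
  apply: cvg_at_right_filter.
  apply: (@cvg_comp _ _ _ (fun u => tau - u) (gammaP i)); last exact: continuous_gammaP.
  by apply: cvgB; [exact: cvg_cst|exact: cvg_id].
have := @continuous_FTC2 R phi Phi 0 tau tau0 (continuous_subspaceT cphi).
have LR : derivable_oo_LRcontinuous Phi 0 tau.
  split.
  - by move=> t; rewrite in_itv/= => /andP[t0 _]; case: (dPhi t t0).
  - exact: cPhi0.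
  - by apply: cvg_at_left_filter; exact: is_derive_continuous (dPhi _ tau0).
move=> /(_ LR) FTC.
have : \int[leb]_(x in `[0, tau]) phi x = Phi tau - Phi 0.
  rewrite /Rintegral FTC//.
  by move=> t; rewrite in_itv/= => /andP[t0 _]; exact/is_derive_derive1/dPhi.
rewrite /phi RintegralB//; [|exact: integrable_continuous..].
rewrite {1}/Phi big1; last by move=> i _; rewrite subrr gammaP_at0 mul0r.
rewrite sub0r /Phi subr0 => /eqP; rewrite subr_eq => /eqP ->.
rewrite addrA -[LHS]add0r; congr (_ + _); apply/esym/eqP; rewrite subr_eq0.
by apply/eqP; apply: eq_bigr => i _; rewrite U0.
Qed.

End pathwise.

(** * Variance under almost sure equality and for centered variables *)

Section variance_ae.
Context d (T : measurableType d) (R : realType) (P : probability T R).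

Lemma variance_ae_eq (Z Z' : T -> R) :
  measurable_fun setT Z -> measurable_fun setT Z' ->
  {ae P, forall w, Z w = Z' w} -> ('V_P[Z] = 'V_P[Z'])%E.
Proof.
move=> mZ mZ' ZZ'.
have EZ : ('E_P[Z] = 'E_P[Z'])%E.
  rewrite unlock; apply: ae_eq_integral => //; [exact/measurable_EFinP..|].
  by apply: filterS ZZ' => w /= -> _.
rewrite /variance unlock EZ unlock; apply: ae_eq_integral => //.
- apply/measurable_EFinP; apply: measurable_funM; exact: measurable_funB.
- apply/measurable_EFinP; apply: measurable_funM; exact: measurable_funB.
- by apply: filterS ZZ' => w /= wE _; rewrite /= -!/(_ * _) /GRing.mul/= wE.
Qed.

Lemma variance_centered (Z : T -> R) : square_integrable P Z ->
  \int[P]_w Z w = 0 -> fine 'V_P[Z]%E = \int[P]_w (Z w ^+ 2).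
Proof.
move=> LZ mean0; rewrite /variance unlock.
have -> : ('E_P[Z] = 0)%E.
  rewrite unlock -[LHS]fineK; last first.
    by apply: integrable_fin_num => //; exact: square_integrable_integrable.
  by rewrite -[fine _]/(\int[P]_w Z w) mean0.
rewrite unlock; congr fine; apply: eq_integral => w _ /=.
by congr (_%:E); rewrite -[LHS]/((Z w - 0) * (Z w - 0)) subr0.
Qed.

End variance_ae.

(** * Moments of Brownian motion recentered at time 0 *)

Section brownian.
Context {R : realType} d (T : measurableType d) (P : probability T R).
Variable B : R -> {RV P >-> R}.
Hypothesis B_bm : brownian_motion B.
Implicit Types s t u : R.

Let W s w := B s w - B 0 w.

Let mW s : measurable_fun setT (W s).
Proof. exact: measurable_funB. Qed.

Lemma brownian_L2 s : 0 <= s -> square_integrable P (W s).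
Proof.
rewrite le_eqVlt => /predU1P[<-|s0].
  have -> : W 0 = cst 0 by apply/funext => w; rewrite /W subrr.
  exact: square_integrable_cst.
have [_ _ /(_ 0 s (lexx 0) s0) law _] := B_bm.
by rewrite subr0 in law; exact: (normal_law_L2 (mW s) (ltW s0) law).
Qed.

Lemma brownian_mean s : 0 <= s -> \int[P]_w W s w = 0.
Proof.
rewrite le_eqVlt => /predU1P[<-|s0].
  have -> : W 0 = cst 0 by apply/funext => w; rewrite /W subrr.
  by rewrite Rintegral_cst// mul0r.
have [_ _ /(_ 0 s (lexx 0) s0) law _] := B_bm.
by rewrite subr0 in law; exact: (normal_law_mean (mW s) (ltW s0) law).
Qed.

Lemma brownian_second_moment s : 0 <= s -> \int[P]_w (W s w ^+ 2) = s.
Proof.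
rewrite le_eqVlt => /predU1P[<-|s0].
  have -> : W 0 = cst 0 by apply/funext => w; rewrite /W subrr.
  under eq_Rintegral do rewrite /= expr0n/=.
  by rewrite /Rintegral integral0.
have [_ _ /(_ 0 s (lexx 0) s0) law _] := B_bm.
by rewrite subr0 in law; exact: (normal_law_second_moment (mW s) (ltW s0) law).
Qed.

(** Polarization: 2 W_s W_u = W_u^2 + W_s^2 - (B_u - B_s)^2 for s <= u, with second moments u, s and
    u - s. *)
Lemma brownian_cov s u : 0 <= s -> 0 <= u ->
  \int[P]_w (W s w * W u w) = Num.min s u.
Proof.
wlog su : s u / s <= u => [H s0 u0|s0 u0].
  have [su|us] := leP s u; first by rewrite H// min_l.
  rewrite -[RHS](min_r (ltW us)) minC -H ?(ltW us)//.
  by apply: eq_Rintegral => w _; rewrite mulrC.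
rewrite min_l//; move: su; rewrite le_eqVlt => /predU1P[<-|su].
  exact: brownian_second_moment.
have [_ _ /(_ s u s0 su) law _] := B_bm.
have mD : measurable_fun setT (fun w => B u w - B s w) by exact: measurable_funB.
have us0 : 0 <= u - s by rewrite subr_ge0 ltW.
have [LWs LWu] := (brownian_L2 s0, brownian_L2 u0).
have LD := normal_law_L2 mD us0 law.
have -> : \int[P]_w (W s w * W u w) =
    \int[P]_w (2^-1 * (W u w ^+ 2 + W s w ^+ 2 - (B u w - B s w) ^+ 2)).
  by apply: eq_Rintegral => w _; rewrite /W; field.
have [_ i1] := LWs; have [_ i2] := LWu; have [_ i3] := LD.
have i12 : P.-integrable setT (EFin \o (fun w => W u w ^+ 2 + W s w ^+ 2)).
  by have := integrableD measurableT i2 i1.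
rewrite RintegralZl//; last by have := integrableB measurableT i12 i3.
rewrite RintegralB// RintegralD// !brownian_second_moment//.
rewrite (normal_law_second_moment mD us0 law).
by field.
Qed.

Lemma brownian_continuous w : {within `[0, +oo[, continuous (W ^~ w)}.
Proof.
have [_ cB _ _] := B_bm.
move=> t; apply: (@cvgB _ R^o); first exact: cB.
exact: cvg_cst.
Qed.

End brownian.

(** * Identification of the integrated variance *)

Section integrated_variance_ou.
Context {R : realType} d (T : measurableType d) (P : probability T R).
Notation leb := (@lebesgue_measure R).
Variables (N : nat) (B : R -> {RV P >-> R}) (Y : R -> 'I_N.+1 -> {RV P >-> R}).
Hypotheses (B_bm : brownian_motion B) (Y_ou : stationary_ou B Y).
Variable tau : R.
Hypothesis tau0 : 0 <= tau.

Let W s w := B s w - B 0 w.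
Let X w := \sum_(i < N.+1) gammaP i tau * Y 0 i w.
Let H s w := psi N (tau - s) * W s w.

Let lawX : has_normal_law P X 0 (initial_variance N tau).
Proof.
have [_ _ law _] := Y_ou.
have := law (\col_i gammaP i tau).
have -> : (fun w => \sum_(i < N.+1) (\col_i gammaP i tau) i 0 * Y 0 i w) = X.
  by apply/funext => w; apply: eq_bigr => i _; rewrite mxE.
suff -> : ((\col_i gammaP i tau)^T *m ou_invariant_cov N.+1 *m
    \col_i gammaP i tau) 0 0 = initial_variance N tau by [].
rewrite mxE /initial_variance exchange_big/=; apply: eq_bigr => j _.
rewrite [X in X * _]mxE mulr_suml; apply: eq_bigr => i _.
by rewrite ou_invariant_covE !mxE; ring.
Qed.

Let var0 : 0 <= initial_variance N tau.
Proof.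
by do 2 (apply: sumr_ge0 => ? _); rewrite !mulr_ge0 ?gammaP_ge0// ltW// ou_cov_gt0.
Qed.

Let mX : measurable_fun setT X.
Proof. by apply: measurable_sum => i; apply: measurable_funM. Qed.

Let LX : square_integrable P X. Proof. exact: normal_law_L2 lawX. Qed.

Let mH s : measurable_fun setT (H s).
Proof. by apply: measurable_funM => //; exact: measurable_funB. Qed.

Let cpsi : continuous (fun u : R => psi N (tau - u)).
Proof.
move=> u; apply: (@cvg_comp _ _ _ (fun u => tau - u) (psi N)); last exact: continuous_psi.
by apply: cvgB; [exact: cvg_cst|exact: cvg_id].
Qed.

Let cH w : {within `[0, +oo[, continuous (H ^~ w)}.
Proof.
move=> t; apply: cvgM; last exact: (@brownian_continuous _ _ _ P B B_bm w t).
by have := continuous_subspaceT cpsi; exact.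
Qed.

Let LH s : 0 <= s -> s <= tau -> square_integrable P (H s).
Proof. by move=> s0 _; apply: square_integrableZ; exact: brownian_L2. Qed.

(** E H_s^2 = psi_N(tau - s)^2 s, and psi_N <= 1 because 1 minus the sum of psi_0, ..., psi_N is P_N
    >= 0. *)
Let HM s : 0 <= s -> s <= tau -> \int[P]_w (H s w ^+ 2) <= tau.
Proof.
move=> s0 st; under eq_Rintegral do rewrite exprMn.
have [_ iW] := brownian_L2 B_bm s0.
rewrite RintegralZl// (brownian_second_moment B_bm s0).
have t0 : 0 <= tau - s by rewrite subr_ge0.
rewrite (le_trans _ st)// ler_piMl// exprn_ile1 ?psi_ge0//.
have := gammaP_ge0 N t0; rewrite /gammaP big_ord_recr/= subr_ge0.
apply: le_trans; rewrite lerDr; apply: sumr_ge0 => i _; exact: psi_ge0.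
Qed.

Let sigma_generated_preimage (I : Type) (D : set I) (F : I -> T -> R) (Z : T -> R) (A : set R) :
  measurable_fun (setT : set (g_sigma_algebraType
    [set A | exists2 i, D i & exists2 U, measurable U & A = F i @^-1` U])) Z ->
  measurable A -> sigma_generated D F (Z @^-1` A).
Proof. by move=> mZ mA; have := mZ measurableT A mA; rewrite setTI. Qed.

Let measurable_generator (I : Type) (D : set I) (F : I -> T -> R) i : D i ->
  measurable_fun (setT : set (g_sigma_algebraType
    [set A | exists2 i, D i & exists2 U, measurable U & A = F i @^-1` U])) (F i).
Proof.
move=> Di _ A mA; rewrite setTI; apply: sub_sigma_algebra.
by exists i => //; exists A.
Qed.

(** X is measurable for the sigma-algebra of Y_0 and W_s for that of B. These are independent, and X
    has mean 0. *)
Let indXW s : 0 <= s -> \int[P]_w (X w * W s w) = 0.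
Proof.
move=> s0; have LW := brownian_L2 B_bm s0.
rewrite Rintegral_indepM//; first by rewrite (normal_law_mean mX var0 lawX) mul0r.
move=> A C mA mC; have [_ _ _ ind] := Y_ou; apply: ind.
  apply: sigma_generated_preimage => //.
  apply: measurable_sum => i; apply: measurable_funM => //.
  exact: (@measurable_generator _ _ (fun i w => Y 0 i w) i).
apply: sigma_generated_preimage => //.
apply: measurable_funB.
  by apply: (@measurable_generator _ _ (fun t w => B t w) s); rewrite /= in_itv/= andbT.
by apply: (@measurable_generator _ _ (fun t w => B t w) 0); rewrite /= in_itv/= andbT.
Qed.

Let I w := time_integral H tau w.

Let LI : square_integrable P I.
Proof. exact: (square_integrable_time_integral mH cH tau0 LH HM). Qed.

Let meanI : \int[P]_w I w = 0.
Proof.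
rewrite (mean_time_integral mH cH tau0 LH HM).
transitivity (\int[leb]_(s in `[0, tau]) (0 : R)); last by rewrite /Rintegral integral0.
apply: eq_Rintegral => s /set_mem; rewrite /= in_itv/= => /andP[s0 _].
rewrite RintegralZl//; last exact/square_integrable_integrable/brownian_L2.
by rewrite (brownian_mean B_bm s0) mulr0.
Qed.

Let covXI : \int[P]_w (X w * I w) = 0.
Proof.
rewrite (Rintegral_time_integralM mH cH tau0 LH HM LX).
transitivity (\int[leb]_(s in `[0, tau]) (0 : R)); last by rewrite /Rintegral integral0.
apply: eq_Rintegral => s /set_mem; rewrite /= in_itv/= => /andP[s0 _].
under eq_Rintegral do rewrite mulrCA.
rewrite RintegralZl//; last by apply: square_integrableM => //; exact: brownian_L2.
by rewrite indXW// mulr0.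
Qed.

Let varI : \int[P]_w (I w ^+ 2) = ou_variance N tau - initial_variance N tau.
Proof.
rewrite (second_moment_time_integral mH cH tau0 LH HM).
rewrite -(integral_psi_psi_min N tau0).
apply: eq_Rintegral => s /set_mem; rewrite /= in_itv/= => /andP[s0 _].
apply: eq_Rintegral => u /set_mem; rewrite /= in_itv/= => /andP[u0 _].
have [Ls Lu] := (brownian_L2 B_bm s0, brownian_L2 B_bm u0).
under eq_Rintegral do rewrite mulrACA.
rewrite RintegralZl//; last exact: square_integrableM.
by rewrite (brownian_cov B_bm s0 u0).
Qed.

Let integral_decomposition : {ae P, forall w,
  \int[leb]_(s in `[0, tau]) Y s ord0 w = X w + I w}.
Proof.
have [cY YE _ _] := Y_ou.
apply: filterS YE => w Yw.
pose Yc s i := Y (Num.max 0 s) i w; pose Wc s := W (Num.max 0 s) w.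
have YcE t i : 0 <= t -> Yc t i = Y t i w by move=> t0; rewrite /Yc max_r.
have path := @ou_path_integral R N Yc Wc.
have cYc i : continuous (Yc ^~ i).
  exact: (continuous_comp_max0 (f := fun s => Y s i w)).
have cWc : continuous Wc.
  apply: (continuous_comp_max0 (f := fun s => W s w)).
  exact: (brownian_continuous B_bm).
have YcS t i : 0 <= t -> Yc t i = Yc 0 i +
  \int[leb]_(s in `[0, t]) (\sum_(j < N.+1) ou_drift N.+1 i j * Yc s j) +
  ou_noise N.+1 i 0 * Wc t.
  move=> t0; rewrite !YcE// Yw// /Wc max_r//; congr (_ + _ + _).
  apply: eq_Rintegral => s /set_mem; rewrite /= in_itv/= => /andP[s0 _].
  by apply: eq_bigr => j _; rewrite YcE.
have := path cYc cWc YcS tau tau0.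
have -> : \int[leb]_(s in `[0, tau]) Yc s ord0 = \int[leb]_(s in `[0, tau]) Y s ord0 w.
  by apply: eq_Rintegral => s /set_mem; rewrite /= in_itv/= => /andP[s0 _]; rewrite YcE.
move=> ->; congr (_ + _).
  by apply: eq_bigr => i _; rewrite YcE.
apply: eq_Rintegral => s /set_mem; rewrite /= in_itv/= => /andP[s0 _].
by rewrite /Wc max_r.
Qed.

(** The second moment of X + I has no cross term, and [initial_variance] cancels between the moments
    of X and I. *)
Lemma integrated_variance_ou :
  integrated_variance P (fun s w => Y s ord0 w) tau = ou_variance N tau.
Proof.
have [cY _ _ _] := Y_ou.
have LXI := square_integrableD LX LI.
rewrite /integrated_variance (variance_ae_eq _ _ integral_decomposition); first last.
- by case: LXI.
- by apply: (measurable_time_integral (H := fun s w => Y s ord0 w)) => // s.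
have [[mX' iX2] [mI iI2]] := (LX, LI).
have [iX iI] := (square_integrable_integrable LX, square_integrable_integrable LI).
have iXI := square_integrableM LX LI.
rewrite variance_centered//; last first.
  by rewrite RintegralD// (normal_law_mean mX var0 lawX) meanI addr0.
transitivity (\int[P]_w ((X w ^+ 2 + I w ^+ 2) + 2 * (X w * I w))).
  by apply: eq_Rintegral => w _; ring.
have i2 : P.-integrable setT (EFin \o (fun w => X w ^+ 2 + I w ^+ 2)).
  by have := integrableD measurableT iX2 iI2.
rewrite RintegralD//; last by have := integrableZl measurableT 2 iXI.
rewrite RintegralD// RintegralZl// covXI mulr0 addr0 varI.
by rewrite (normal_law_second_moment mX var0 lawX) subrKC.
Qed.

End integrated_variance_ou.

(** * Fourier coefficients of the top-hat kernel *)

Section fourier_tophat.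
Context {R : realType}.
Notation leb := (@lebesgue_measure R).
Implicit Types (r x : R) (n : nat).

(** Induction through |sin((m + 1) x)| <= |sin(m x)| |cos x| + sin x. Strictness enters at n = 2,
    from |cos x| < 1. *)
Lemma ltr_norm_sin_mul n x : 0 < x -> x < pi -> (1 < n)%N ->
  `|sin (n%:R * x)| < n%:R * sin x.
Proof.
move=> x0 xpi; have s0 : 0 < sin x by apply: sin_gt0_pi; rewrite x0 xpi.
have step m : `|sin (m.+1%:R * x)| <= `|sin (m%:R * x)| * `|cos x| + sin x.
  rewrite -natr1 mulrDl mul1r sinD (le_trans (ler_normD _ _))// !normrM lerD2l.
  by rewrite (gtr0_norm s0) ler_piMl ?(ltW s0)// ler_norml cos_geN1 cos_le1.
have cos1 : `|cos x| < 1.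
  rewrite -(@ltr_pXn2r _ 2)// ?nnegrE// expr1n real_normK ?num_real//.
  have := cos2Dsin2 x; have : 0 < sin x ^+ 2 by rewrite exprn_gt0.
  by lra.
elim: n => // -[//|[|n] IH] _.
  apply: le_lt_trans (step 1%N) _; rewrite mul1r (gtr0_norm s0).
  rewrite -[2]/(1 + 1) mulrDl mul1r ltrD2r gtr_pMr//.
apply: le_lt_trans (step n.+2) _; rewrite -[X in _ < X](_ : n.+2%:R * sin x + sin x = _); last first.
  by rewrite -[n.+3%:R]natr1 [RHS]mulrDl mul1r.
rewrite ltrD2r.
by apply: le_lt_trans (IH isT); rewrite ler_piMr// ltW.
Qed.

Lemma ltr_norm_sinc n x : 0 < x -> x < pi -> (1 < n)%N ->
  `|sin (n%:R * x) / (n%:R * x)| < sin x / x.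
Proof.
move=> x0 xpi n1; have n0 : 0 < n%:R :> R by rewrite ltr0n ltnW.
rewrite normrM normfV (gtr0_norm (mulr_gt0 n0 x0)) invfM mulrA.
rewrite ltr_pM2r ?invr_gt0// ltr_pdivrMr// [ltRHS]mulrC.
exact: ltr_norm_sin_mul.
Qed.

(** Only the copies of the support centered at 0 and 1 meet ]0, 1[, and r < 1/2 keeps them disjoint,
    so their indicators add up. *)
Lemma tophat_itv01 r x : r < 1 / 2 -> 0 < x < 1 ->
  tophat r x = (2 * r)^-1 * ((x <= r)%R%:R + (1 - r <= x)%R%:R).
Proof.
move=> r2 /andP[x0 x1]; rewrite /tophat indicE; congr (_ * _).
have [xr|rx] := leP x r.
  rewrite mem_set; last by exists 0; rewrite /= subr0 gtr0_norm.
  by rewrite (_ : (1 - r <= x) = false) ?addr0//; apply/negbTE; rewrite -ltNge; lra.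
rewrite add0r; congr (_%:R); have [xr|xr] := leP (1 - r) x.
  by rewrite mem_set//; exists 1; rewrite /= ler_norml; apply/andP; split; lra.
congr nat_of_bool; apply: memNset => -[m /=]; rewrite ler_norml => /andP[h1 h2].
have m0 : (0 < m).
  rewrite -(@ltr_int R); apply: lt_le_trans (_ : x - r <= _); last by lra.
  by rewrite subr_gt0.
have m1 : (m < 1) by rewrite -(@ltr_int R); lra.
by move: m0 m1; case: m {h1 h2} => [[|[|m]]|].
Qed.

(** The pieces [0, r] and [1 - r, 1] contribute equally, by periodicity of the sine. The real part
    is enough, since the other factors of the critical equation are real. *)
Lemma Re_fourier_coef_tophat r n : 0 < r -> r < 1 / 2 -> (0 < n)%N ->
  complex.Re (fourier_coef (tophat r) n%:Z) =
  sin (n%:R * (2 * pi * r)) / (n%:R * (2 * pi * r)).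
Proof.
move=> r0 r2 n0; rewrite /fourier_coef/=.
pose w : R := wavenumber n%:Z.
have wE : w = (pi *+ 2) *+ n.
  by rewrite /w /wavenumber -pmulrn -[RHS]mulr_natr -[pi *+ 2]mulr_natl.
have w0 : 0 < w by rewrite wE mulrn_wgt0// mulrn_wgt0// pi_gt0.
have sinw : sin w = 0.
  by rewrite wE; have := periodicn (@sinD2pi R) n 0; rewrite add0r sin0.
have cosw : cos w = 1.
  by rewrite wE; have := periodicn (@cosD2pi R) n 0; rewrite add0r cos0.
pose c x := (2 * r)^-1 * cos (w * x).
have cc : continuous c.
  move=> x; apply: cvgM; first exact: cvg_cst.
  apply: (@cvg_comp _ _ _ (fun x => w * x) cos); last exact: continuous_cos.
  by apply: cvgM; [exact: cvg_cst|exact: cvg_id].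
pose C x := (2 * r)^-1 * (w^-1 * sin (w * x)).
have dC x : is_derive x (1 : R) C (c x).
  refine (is_derive_eq (is_deriveZ_fun _ (is_deriveZ_fun _ (is_derive_comp_fun
    (is_derive_sin (w * x)) (is_deriveZ_fun w (is_derive_id x (1 : R)))))) _).
  by rewrite /c mulr1; congr (_ * _); rewrite mulrC mulfK// gt_eqF.
pose A : set R := `[0, r]%classic; pose B : set R := `[1 - r, 1]%classic.
have icD (D : set R) : measurable D -> D `<=` `[0, 1] -> leb.-integrable D (EFin \o c).
  by move=> mD D01; apply: integrableS (integrable_continuous 0 1 cc).
transitivity (\int[leb]_(x in `]0, 1[) ((c \_ A) x + (c \_ B) x)).
  apply: eq_Rintegral => x /set_mem; rewrite /= in_itv/= => /andP[x0 x1].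
  rewrite !mul0r subr0 cosN -/w (tophat_itv01 r2) ?x0// !patchE.
  rewrite (_ : (x \in A) = (x <= r)); last first.
    by rewrite /A mem_setE in_itv/= (ltW x0).
  rewrite (_ : (x \in B) = (1 - r <= x)); last first.
    by rewrite /B mem_setE in_itv/= (ltW x1) andbT.
  (* A restricted function takes the value [point] off its domain; in R this is 0. *)
  have p0 : point = 0 :> R by [].
  by rewrite p0 /c; case: (x <= r); case: (1 - r <= x) => /=; ring.
have mA : measurable A by exact: measurable_itv.
have mB : measurable B by exact: measurable_itv.
have s01 : (`]0, 1[%classic : set R) `<=` `[0, 1].
  by apply: subset_itvW.
have intP (P : set R) : measurable P -> leb.-integrable `]0, 1[ (EFin \o (c \_ P)).
  move=> mP; rewrite -restrict_EFin; apply/integrable_restrict => //.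
  by apply: icD; [exact: measurableI|move=> x [/s01]].
rewrite RintegralD//; [|exact: intP..].
rewrite -!Rintegral_mkcondr.
have -> : `]0, 1[ `&` A = `]0, r]%classic.
  apply/seteqP; split => x; rewrite /A/= !in_itv/=.
    by move=> [/andP[-> _] /andP[_ ->]].
  move=> /andP[x0 xr]; rewrite x0 xr (ltW x0); split => //=; lra.
have -> : `]0, 1[ `&` B = `[(1 - r), 1[%classic.
  apply/seteqP; split => x; rewrite /B/= !in_itv/=.
    by move=> [/andP[_ ->] /andP[-> _]].
  move=> /andP[x0 xr]; rewrite x0 xr (ltW xr); split => //=; rewrite andbT; lra.
have r1 : 1 - r <= 1 by rewrite gerBl ltW.
rewrite Rintegral_itv_obnd_cbnd; last first.
  by apply: icD => // x; rewrite /= !in_itv/= => /andP[x0 xr]; rewrite (ltW x0)/=; lra.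
rewrite Rintegral_itv_bndo_bndc; last first.
  by apply: icD => // x; rewrite /= !in_itv/= => /andP[x0 xr]; rewrite (ltW xr) andbT; lra.
rewrite (Rintegral_is_derive (ltW r0) cc dC) (Rintegral_is_derive r1 cc dC).
rewrite /C mulr0 sin0 mulr1 sinw mulrBr mulr1 sinB sinw cosw !mul0r !mulr0 mul1r.
have -> : n%:R * (2 * pi * r) = w * r by rewrite /w /wavenumber -pmulrn; ring.
have w0' : w != 0 by rewrite gt_eqF.
have r0' : r != 0 by rewrite gt_eqF.
by field; rewrite w0' r0'.
Qed.

End fourier_tophat.

(** * The dispersion relation in terms of the Laplace comparison *)

Section dispersion_function.
Context {R : realType}.
Notation leb := (@lebesgue_measure R).

Lemma F_gammaP N (t : R) : 0 <= t -> F_ N.+1 t = gammaP N t.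
Proof.
move=> t0; have f0 : N`!%:R != 0 :> R by rewrite pnatr_eq0 -lt0n fact_gt0.
have dF (x : R) : is_derive x (1 : R) (fun x => N`!%:R * gammaP N x) (expR (- x) * x ^+ N).
  refine (is_derive_eq (is_deriveZ_fun _ (is_derive_gammaP N x)) _).
  by rewrite /psi mulVKf// mulrC.
have cf : continuous (fun x : R => expR (- x) * x ^+ N).
  move=> x; apply: cvgM; last exact: exprn_continuous.
  apply: (cvg_comp _ expR); last exact: continuous_expR.
  by apply: cvgN; exact: cvg_id.
rewrite /F_ (Rintegral_is_derive t0 cf dF) gammaP_at0 mulr0 subr0 mulKf//.
Qed.

Lemma Re_real_complex_scale (x y : R) (z : R[i]) :
  complex.Re (real_complex R x * z * real_complex R y) = x * complex.Re z * y.
Proof. by case: z => a b /=; ring. Qed.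

(** Kept in the extended reals, where the monotonicity in k asks for no finiteness. *)
Definition scaled_laplace N (k : R) : \bar R :=
  (\int[leb]_(t in `[0%R, +oo[)
    (k * (gammaP N t ^+ 2 * expR (- (k * ou_variance N t))))%:E)%E.

Lemma scaled_laplace_ge0 N k : 0 <= k -> (0 <= scaled_laplace N k)%E.
Proof.
move=> k0; apply: integral_ge0 => t _.
by rewrite lee_fin mulr_ge0// mulr_ge0 ?sqr_ge0 ?expR_ge0.
Qed.

Lemma scaled_laplace_nincr N k m : 0 < k -> k <= m ->
  (scaled_laplace N m <= scaled_laplace N k)%E.
Proof.
apply: (@laplace_transform_nincr R (gammaP N) (ou_variance N)
  (fun t => 2 * autocov_primitive N t)).
- exact: continuous_gammaP.
- move=> t; apply: cvgM; first exact: cvg_cst.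
  exact: continuous_autocov_primitive.
- exact: is_derive_ou_variance.
- exact: ou_variance_at0.
- by move=> t t0; rewrite mulr_ge0// autocov_primitive_ge0.
- by move=> t t0; rewrite mulr_gt0// autocov_primitive_gt0.
- by move=> x y x0 xy; rewrite ler_pM2l// autocov_primitive_le.
- move=> x y x0 xy; rewrite mulrCA [leRHS]mulrCA ler_pM2l//.
  exact: gammaP_autocov_ratio.
Qed.

Lemma fine_scaled_laplace N k : 0 < k -> fine (scaled_laplace N k) =
  k * \int[leb]_(t in `[0, +oo[)
        (gammaP N t ^+ 2 * expR (- (k * ou_variance N t))).
Proof.
move=> k0; rewrite /scaled_laplace; under eq_integral do rewrite EFinM.
rewrite ge0_integralZl//.
(* For an infinite integral both sides are 0: [fine] sends infinities to 0, and k > 0 keeps the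
   value infinite. *)
- rewrite /Rintegral; move: (integral _ _ _) => [x| |] //=.
    by rewrite gt0_muley ?lte_fin//= mulr0.
  by rewrite gt0_muleNy ?lte_fin//= mulr0.
- apply/measurable_EFinP/measurable_funTS; apply: continuous_measurable_fun => t.
  apply: cvgM.
    by rewrite expr2; under eq_fun do rewrite expr2; apply: cvgM; exact: continuous_gammaP.
  apply: (cvg_comp _ expR); last exact: continuous_expR.
  apply: cvgN; apply: cvgM; first exact: cvg_cst.
  exact: is_derive_continuous (is_derive_ou_variance N t).
- by move=> t _; rewrite lee_fin mulr_ge0 ?sqr_ge0 ?expR_ge0.
- by rewrite lee_fin ltW.
Qed.

(** The rate multiplying V in the exponent of I_k, where a is alpha^(2K+1) and g is G(rho). *)
Definition mode_rate (a g : R) (k : nat) : R :=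
  (2 * pi * k%:R) ^+ 2 * g ^+ 2 / (2 * a).

Lemma mode_rate_gt0 a g k : 0 < a -> 0 < g -> (0 < k)%N -> 0 < mode_rate a g k.
Proof.
move=> a0 g0 k0; apply: divr_gt0; last exact: mulr_gt0.
by rewrite mulr_gt0// exprn_gt0// mulr_gt0 ?ltr0n// mulr_gt0// pi_gt0.
Qed.

Lemma mode_rate_le a g k m : 0 < a -> 0 < g -> (k <= m)%N ->
  mode_rate a g k <= mode_rate a g m.
Proof.
move=> a0 g0 km; rewrite /mode_rate ler_pM2r ?invr_gt0 ?mulr_gt0//.
rewrite ler_pM2r ?exprn_gt0// lerXn2r ?nnegrE ?mulr_ge0 ?pi_ge0//.
by rewrite ler_pM2l ?ler_nat// mulr_gt0// pi_gt0.
Qed.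

(** Solving l = |q|^2 g^2 / (2 a) for |q|^2 / a gives 2 l / g^2: the mode enters only through the
    rate l, and the prefactor 2 / g^2 is common to all modes. *)
Lemma wavenumber_I0 N (V G : R -> R) (alpha rho : R) (k : nat) :
    0 < alpha -> 0 < G rho -> (0 < k)%N ->
    (forall t, 0 <= t -> V t = ou_variance N t) ->
  `|wavenumber k%:Z| ^+ 2 * I0 V G N.+1 k%:Z alpha rho =
  2 / G rho ^+ 2 *
    fine (scaled_laplace N (mode_rate (alpha ^+ (2 * N.+1 + 1)) (G rho) k)).
Proof.
move=> alpha0 g0 k0 VE; rewrite /I0 real_normK ?num_real//.
set a := alpha ^+ _; have a0 : 0 < a by rewrite exprn_gt0.
rewrite fine_scaled_laplace; last exact: mode_rate_gt0.
have -> : wavenumber k%:Z = 2 * pi * k%:R :> R by rewrite /wavenumber -pmulrn.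
have -> : \int[leb]_(tau in `[0, +oo[) (F_ N.+1 tau ^+ 2 *
      expR (- ((2 * pi * k%:R) ^+ 2 * G rho ^+ 2 / (2 * a) * V tau))) =
    \int[leb]_(t in `[0, +oo[) (gammaP N t ^+ 2 *
      expR (- (mode_rate a (G rho) k * ou_variance N t))).
  apply: eq_Rintegral => t /set_mem; rewrite /= in_itv/= andbT => t0.
  by rewrite F_gammaP// VE.
move: (Rintegral _ _ _) => z; rewrite /mode_rate.
by field; rewrite !lt0r_neq0.
Qed.

End dispersion_function.

Theorem mainTheorem11 (R : realType)
  (r : R) (r_gt0 : 0 < r) (r_lt : r < 1 / 2)
  (rho0 : R) (rho0_gt0 : 0 < rho0)
  (alpha : R) (alpha_gt0 : 0 < alpha)
  (K : nat) (K_gt0 : (0 < K)%N)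
  (G : R -> R)
  (G_bounded : exists M : R, forall x : R, 0 <= x -> G x <= M)
  (G_pos : forall x : R, 0 <= x -> 0 < G x)
  (G_decr : forall x y : R, 0 <= x -> x <= y -> G y <= G x)
  (G_deriv : derivable G rho0 1)
  (dG_neg : (G^`())%classic rho0 < 0)
  (d : measure_display) (T : measurableType d) (P : probability T R)
  (B : R -> {RV P >-> R}) (B_bm : brownian_motion B)
  (Y : R -> 'I_K -> {RV P >-> R}) (Y_ou : stationary_ou B Y) :
  let V : R -> R :=
    integrated_variance P (fun s w => Y s (Ordinal K_gt0) w) in
  let critical (n : int) : Prop :=
    real_complex R (- rho0 * G rho0 * (G^`())%classic rho0)
      * fourier_coef (tophat r) n
      * real_complex R (`|wavenumber n| ^+ 2 * I0 V G K n alpha rho0) = 1 in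
  critical 1 -> forall n : int, 2 <= n -> ~ critical n.
Proof.
move=> V critical crit1 [n|//] n2.
case: K K_gt0 Y Y_ou @V @critical crit1 => [//|N] K_gt0 Y Y_ou V critical crit1 critn.
have VE t : 0 <= t -> V t = ou_variance N t.
  move=> t0; rewrite /V (_ : Ordinal K_gt0 = ord0); last exact: val_inj.
  exact: (integrated_variance_ou B_bm Y_ou).
have g0 : 0 < G rho0 by apply: G_pos; exact: ltW.
have a0 : 0 < alpha ^+ (2 * N.+1 + 1) by rewrite exprn_gt0.
pose l := mode_rate (alpha ^+ (2 * N.+1 + 1)) (G rho0).
pose h k := scaled_laplace N (l k).
have l_gt0 k : (0 < k)%N -> 0 < l k by exact: mode_rate_gt0.
have h_ge0 k : (0 < k)%N -> (0 <= h k)%E.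
  by move=> k0; rewrite scaled_laplace_ge0 ?ltW ?l_gt0.
have critE (k : nat) : (0 < k)%N -> critical k%:Z ->
    (- rho0 * G rho0 * (G^`())%classic rho0) * (2 / G rho0 ^+ 2) *
    (sin (k%:R * (2 * pi * r)) / (k%:R * (2 * pi * r)) * fine (h k)) = 1.
  move=> k0 /(congr1 (@complex.Re R)); rewrite Re_real_complex_scale.
  rewrite Re_fourier_coef_tophat// (wavenumber_I0 alpha_gt0 g0 k0 VE)/= => e.
  rewrite -[RHS]e -/(l k) -/(h k); move: (fine _) (sin _ / _) => x y; ring.
have k2 : (1 < n)%N by [].
have eq1 := critE 1%N isT crit1; have {critn} eqn := critE n (ltnW k2) critn.
move: eq1 eqn; set c := _ * (2 / _); set x := 2 * pi * r.
have c0 : 0 < c.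
  rewrite /c mulr_gt0 ?divr_gt0 ?exprn_gt0//.
  by rewrite !mulNr oppr_gt0 pmulr_rlt0// mulr_gt0.
have x0 : 0 < x by rewrite !mulr_gt0// pi_gt0.
have xpi : x < pi.
  by rewrite /x mulrAC -[X in _ < X]mul1r ltr_pM2r ?pi_gt0//; lra.
have sinc_lt := ltr_norm_sinc x0 xpi k2.
rewrite !mul1r => eq1 eqn.
(* The critical equation of mode 1 excludes the value 0, hence also an infinite integral, which
   [fine] would send to 0. *)
have D1 : 0 < fine (h 1%N).
  rewrite lt_neqAle fine_ge0 ?h_ge0// andbT eq_sym.
  by apply/eqP => h0; move: eq1; rewrite h0 !mulr0 => /eqP; rewrite eq_sym oner_eq0.
have h1fin : h 1%N \is a fin_num by move: D1; case: (h 1%N) => //=; rewrite ltxx.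
have hle : (h n <= h 1%N)%E.
  by apply: scaled_laplace_nincr; [exact: l_gt0|exact: mode_rate_le (ltnW k2)].
have Dn : fine (h n) <= fine (h 1%N).
  apply: fine_le; [|exact: h1fin|exact: hle].
  rewrite ge0_fin_numE; last exact: h_ge0 (ltnW k2).
  by apply: le_lt_trans hle _; rewrite ltey_eq h1fin.
have Dn0 : 0 <= fine (h n) by apply: fine_ge0; exact: h_ge0 (ltnW k2).
move: (fine (h n)) (fine (h 1%N)) Dn0 D1 Dn eq1 eqn => D D' D0 D'0 DD' eq1 eqn.
(* The two critical equations would give 1 < 1. The n-th Fourier coefficient may be negative, so it
   is bounded by its absolute value before the strict comparison. *)
have := ltxx (1 : R); rewrite -[X in X < _]eqn -[X in _ < X]eq1 => /negP; apply.
rewrite ltr_pM2l//.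
apply: (@le_lt_trans _ _ (`|sin (n%:R * x) / (n%:R * x)| * D')).
  by rewrite (le_trans (ler_wpM2r D0 (ler_norm _)))// ler_wpM2l.
by rewrite ltr_pM2r.
Qed.
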